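(* Let $1\le m\le n-1$ be integers and let $E\subset\mathbb{R}^n$ be a non-empty compact set. Then for all $V\in G(n,m)$ $$\underline{\dim}_{\rm B}\,\pi_VE\le\underline{\dim}_{\rm B}^{\,m}E\quad\text{and}\quad \overline{\dim}_{\rm B}\,\pi_VE\le\overline{\dim}_{\rm B}^{\,m}E,$$ and for $\gamma_{n,m}$-almost all $V\in G(n,m)$ $$\underline{\dim}_{\rm B}\,\pi_VE=\underline{\dim}_{\rm B}^{\,m}E\quad\text{and}\quad \overline{\dim}_{\rm B}\,\pi_VE=\overline{\dim}_{\rm B}^{\,m}E.$$
   Context: $G(n,m)$ is the Grassmannian of $m$-dimensional linear subspaces of $\mathbb{R}^n$, $\gamma_{n,m}$ is the invariant (under the orthogonal group) Borel probability measure on $G(n,m)$, and $\pi_V:\mathbb{R}^n\to V$ is orthogonal projection. For $s>0$ and $r>0$ let $\phi_r^s(x)=\min\{1,(r/|x|)^s\}$ for $x\in\mathbb{R}^n$ (with $\phi_r^s(0)=1$). For non-empty compact $E\subset\mathbb{R}^n$ let $\mathcal{M}(E)$ be the set of Borel probability measures supported by $E$. The capacity $C_r^s(E)$ is defined by $$\frac{1}{C_r^s(E)}=\inf_{\mu\in\mathcal{M}(E)}\int\int\phi_r^s(x-y)\,d\mu(x)\,d\mu(y).$$ The lower and upper $s$-box dimension profiles of $E$ are $$\underline{\dim}_{\rm B}^{\,s}E=\liminf_{r\to0}\frac{\log C_r^s(E)}{-\log r},\qquad \overline{\dim}_{\rm B}^{\,s}E=\limsup_{r\to0}\frac{\log C_r^s(E)}{-\log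 r}.$$ For a non-empty compact set $A$ in a Euclidean space let $N_r(A)$ be the minimum number of sets of diameter $r$ that can cover $A$. The lower and upper box-counting dimensions of $A$ are $$\underline{\dim}_{\rm B}A=\liminf_{r\to0}\frac{\log N_r(A)}{-\log r},\qquad \overline{\dim}_{\rm B}A=\limsup_{r\to0}\frac{\log N_r(A)}{-\log r}.$$ *)

(* Defs.v *)
From HB Require Import structures.
From mathcomp Require Import all_boot all_order all_algebra.
From mathcomp Require Import all_classical all_reals all_analysis.

Set Implicit Arguments.
Unset Strict Implicit.
Unset Printing Implicit Defensive.

Import Order.TTheory GRing.Theory Num.Theory.
Import numFieldNormedType.Exports.

Local Open Scope classical_set_scope.
Local Open Scope ring_scope.

(** [`|x|] on ['rV[R]_n] is the sup norm; it induces the usual topology but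
    not the Euclidean distance, hence [enorm]. *)

Section dot.
Variables (R : realType) (n : nat).
Implicit Types x y : 'rV[R]_n.

Definition dot x y : R := \sum_(i < n) x 0 i * y 0 i.

Let dot_bilinear : bilinear_for *%R *%R dot.
Proof.
split=> [y a u v|x a u v]; rewrite /applyr_head /dot /=.
  by rewrite mulr_sumr -big_split; apply: eq_bigr => i _; rewrite !mxE mulrDl mulrA.
by rewrite mulr_sumr -big_split; apply: eq_bigr => i _; rewrite !mxE mulrDr mulrCA.
Qed.

HB.instance Definition _ :=
  bilinear_isBilinear.Build R 'rV[R]_n 'rV[R]_n R *%R *%R dot dot_bilinear.

Let dotC x y : dot x y = (-1) ^+ false * idfun (dot y x).
Proof. by rewrite expr0 mul1r; apply: eq_bigr => i _; rewrite mulrC. Qed.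

HB.instance Definition _ :=
  isHermitianSesquilinear.Build R 'rV[R]_n false idfun dot dotC.

Let dot_gt0 x : x != 0 -> 0 < dot x x.
Proof.
move=> x0; have sq i : true -> 0 <= x 0 i * x 0 i by rewrite -expr2 sqr_ge0.
rewrite lt_neqAle sumr_ge0 // andbT eq_sym psumr_eq0 //.
apply: contra x0 => /allP x0; apply/eqP/rowP => i; rewrite mxE.
by have := x0 i (mem_index_enum i); rewrite /= mulf_eq0 orbb => /eqP.
Qed.

HB.instance Definition _ := isDotProduct.Build R 'rV[R]_n dot dot_gt0.

Definition enorm x : R := Num.sqrt (dot x x).

Definition diam (U : set 'rV[R]_n) : \bar R :=
  ereal_sup [set (enorm (x - y))%:E | x in U & y in U].

Definition orthocompl (V : {vspace 'rV[R]_n}) : {vspace 'rV[R]_n} :=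
  orthov (dot : {symmetric 'rV[R]_n}) V.

Definition orthoproj (V : {vspace 'rV[R]_n}) : 'End('rV[R]_n) :=
  daddv_pi V (orthocompl V).

Lemma capv_orthocompl V : (V :&: orthocompl V = 0)%VS.
Proof.
apply/eqP; rewrite -subv0; apply/subvP => x /memv_capP[xV /mem_orthovP xV'].
rewrite memv0; apply: contraT => /dot_gt0.
by have /= -> := xV' x xV; rewrite ltxx.
Qed.

Lemma addv_orthocompl V : (V + orthocompl V = fullv)%VS.
Proof.
pose f (x : 'rV[R]_n) : 'rV[R]_(\dim V) := \row_i dot x (vbasis V)`_i.
have f_lin : linear f.
  move=> a u v; apply/rowP => i; rewrite !mxE /dot mulr_sumr -big_split.
  by apply: eq_bigr => j _; rewrite !mxE mulrDl mulrA.
pose fL : {linear 'rV[R]_n -> 'rV[R]_(\dim V)} :=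
  HB.pack f (GRing.isLinear.Build R _ _ _ f f_lin).
have kerf : (lker (linfun fL) <= orthocompl V)%VS.
  apply/subvP => x; rewrite memv_ker lfunE /= => /eqP/rowP fx0.
  apply/mem_orthovP => v /coord_vbasis ->; rewrite /= /dot.
  rewrite -[LHS]/(dot x _) linear_sumr big1 //= => i _.
  by rewrite linearZr /=; have := fx0 i; rewrite !mxE => ->; rewrite mulr0.
apply/eqP; rewrite -dimv_leqif_eq ?subvf // eqn_leq dimvS ?subvf //=.
rewrite dimv_disjoint_sum ?capv_orthocompl //.
rewrite -(limg_ker_dim (linfun fL) fullv) capfv addnC leq_add //.
  by rewrite (leq_trans (dimvS (subvf _))) // dimvf /dim /= mul1n.
exact: dimvS.
Qed.

Lemma orthoprojP (V : {vspace 'rV[R]_n}) x :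
  orthoproj V x \in V /\ (forall v, v \in V -> dot (x - orthoproj V x) v = 0).
Proof.
split; first exact: memv_pi.
move=> v vV; suff /mem_orthovP : x - orthoproj V x \in orthocompl V by apply.
have xD : x \in (V + orthocompl V)%VS by rewrite addv_orthocompl memvf.
rewrite -[X in X - _](daddv_pi_add (capv_orthocompl V) xD) addrAC subrr add0r.
exact: memv_pi.
Qed.

End dot.

Definition borel (T : ptopologicalType) := g_sigma_algebraType (@open T).

HB.instance Definition _ (T : ptopologicalType) := Measurable.on (borel T).

(** The proof of [m <= n] only serves to know that the type is inhabited, as
    measurable types are required to be. *)

Section grassmannian.
Variables (R : realType) (n m : nat).

Definition grassmannian (le_mn : (m <= n)%N) :=
  {V : {vspace 'rV[R]_n} | \dim V == m}.

Variable le_mn : (m <= n)%N.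
Local Notation G := (grassmannian le_mn).

HB.instance Definition _ := SubType.on G.
HB.instance Definition _ := Choice.on G.

Fact grassmannian_inhabited : \dim <<take m (vbasis {:'rV[R]_n})>>%VS == m.
Proof.
have free_take : free (take m (vbasis {:'rV[R]_n})).
  have := basis_free (vbasisP {:'rV[R]_n}).
  by rewrite -{1}[vbasis _ : seq _](cat_take_drop m) => /catl_free.
move: free_take; rewrite /free => /eqP ->; rewrite size_takel // size_tuple.
by rewrite dimvf /dim /= mul1n.
Qed.

HB.instance Definition _ := isPointed.Build G
  (exist _ <<take m (vbasis {:'rV[R]_n})>>%VS grassmannian_inhabited).

Definition projmx (V : G) : 'M[R]_n := lin1_mx (orthoproj (val V)).

(** The usual topology of the Grassmannian, that is, the one of the distance
    [|| pi_V - pi_W ||]. *)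
HB.instance Definition _ := Topological.copy G (initial_topology projmx).

(** [gamma] is invariant under the action [V |-> V *m U] of the orthogonal
    group (as vectors are rows, matrices act on the right). *)
Definition orthogonal_invariant (gamma : probability (borel G) R) :=
  forall U : 'M[R]_n, U *m U^T = 1%:M ->
  forall A : set (borel G), measurable A ->
  gamma [set W | exists2 V, A V &
                 val (W : G) = (linfun (mulmxr U) @: val (V : G))%VS]
  = gamma A.

End grassmannian.
Arguments grassmannian R {n m} le_mn.

Section dimensions.
Variables (R : realType) (n : nat).
Implicit Types (E A : set 'rV[R]_n) (r s : R).
Local Open Scope ereal_scope.

Definition phi r s (x : 'rV[R]_n) : R :=
  (if x == 0 then 1 else Num.min 1 ((r / enorm x) `^ s))%R.

Definition energy r s (mu : probability (borel 'rV[R]_n) R) : \bar R :=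
  \int[mu]_x \int[mu]_y
    (phi r s ((x : 'rV[R]_n) - (y : 'rV[R]_n)))%:E.

(** For closed [E], the probability measures whose support lies in [E]. *)
Definition probabilities_on E : set (probability (borel 'rV[R]_n) R) :=
  [set mu | mu E = 1].

Definition capacity r s E : \bar R :=
  (ereal_inf (energy r s @` probabilities_on E))^-1.

Definition lower_dim_profile s E : \bar R :=
  limf_einf (fun r => lne (capacity r s E) / (- ln r)%:E) 0%R^'+.

Definition upper_dim_profile s E : \bar R :=
  limf_esup (fun r => lne (capacity r s E) / (- ln r)%:E) 0%R^'+.

(** The infimum is a minimum as soon as there is a finite cover; it is [+oo]
    otherwise. *)
Definition covering_number r A : \bar R :=
  ereal_inf [set k%:R%:E | k in [set k : nat |
    exists F : 'I_k -> set 'rV[R]_n,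
      (forall i, diam (F i) = r%:E) /\ A `<=` \bigcup_i F i]].

Definition lower_box_dim A : \bar R :=
  limf_einf (fun r => lne (covering_number r A) / (- ln r)%:E) 0%R^'+.

Definition upper_box_dim A : \bar R :=
  limf_esup (fun r => lne (covering_number r A) / (- ln r)%:E) 0%R^'+.

End dimensions.

(* Main.v *)
Require Import Defs.
From HB Require Import structures.
From mathcomp Require Import all_boot all_order all_algebra.
From mathcomp Require Import all_classical all_reals all_analysis.
From mathcomp Require Import measurable_realfun zify ring lra.

Set Implicit Arguments.
Unset Strict Implicit.
Unset Printing Implicit Defensive.

Import Order.TTheory GRing.Theory Num.Theory.
Import numFieldNormedType.Exports.

Local Open Scope classical_set_scope.
Local Open Scope ring_scope.

(** Write [L = - ln r], and let [I_r] be the infimum of the energies at scale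
    [r], so that the capacity is [1 / I_r]. The theorem follows from two
    comparisons, valid up to powers of [L], which do not affect the growth
    exponents ([limf_einf_growth_le], [limf_esup_growth_le]).

    For every [V], the projection of [E] is covered by at most
    [(a + b L) ^ m / I_r] sets of diameter [r] ([covering_projection_le]): cut
    [V] into cubes of side comparable to [r] and put the uniform measure on one
    point of [E] above each of the [N] cubes met by the projection. Since
    [phi] only increases under projection, its energy is at most [1 / N] times,
    up to constants, a lattice sum of [min(1, 1/|z|^m)] over [|z| <= 1/r], which
    is at most a power of a harmonic sum, because [|z|^m] dominates the product
    of the nonzero coordinates of [z].

    For almost every [V] there is a converse ([capacity_le_covering_ae]). Let
    [mu] nearly minimize the energy. If [N] sets of diameter [r] cover the
    projection of [E], Cauchy-Schwarz shows that the pairs [(x, y)] whose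
    projections are within [r] of each other have [mu * mu]-measure at least
    [1 / N]. The average of this measure over [V] is bounded by the energy, up
    to a constant, since a fixed vector [x] has a projection of length at most
    [r] with probability at most a constant times [(r / |x|) ^ m]
    ([gamma_slab_le]). Markov's inequality and the Borel-Cantelli lemma along
    the scales [exp (- k)] conclude.

    The estimate [gamma_slab_le] only uses the invariance of [gamma]: all
    vectors of the same length play the same role, so that the probability is
    an average over the points of a grid, and it suffices to count the grid
    points close to the orthogonal complement of a given [V]. All of this is
    made uniform in [V] by a basis of [V] that is the identity on [m]
    coordinates and has entries of absolute value at most [1]
    ([adapted_basis]). The measures [mu] are replaced by finitely supported
    ones ([energy_ge_discrete]), so that every average over pairs of points is
    a finite sum. *)

(** * Euclidean geometry *)

Section enorm.
Variables (R : realType) (n : nat).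
Implicit Types x y : 'rV[R]_n.

Lemma dotC x y : dot x y = dot y x.
Proof. by apply: eq_bigr => i _; rewrite mulrC. Qed.

Lemma dot_ge0 x : 0 <= dot x x.
Proof. by apply: sumr_ge0 => i _; rewrite -expr2 sqr_ge0. Qed.

Lemma enorm_ge0 x : 0 <= enorm x. Proof. exact: sqrtr_ge0. Qed.

Lemma enorm_sqr x : enorm x ^+ 2 = dot x x.
Proof. by rewrite sqr_sqrtr // dot_ge0. Qed.

Lemma enorm_eq0 x : (enorm x == 0) = (x == 0).
Proof.
apply/idP/eqP => [|->]; last by rewrite /enorm linear0l sqrtr0.
have -> : (enorm x == 0) = (enorm x ^+ 2 == 0) by rewrite sqrf_eq0.
rewrite enorm_sqr; apply: contraTeq => x0.
rewrite gt_eqF // lt_neqAle dot_ge0 andbT eq_sym.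
rewrite psumr_eq0 => [|i _]; last by rewrite -expr2 sqr_ge0.
apply: contra x0 => /allP x0; apply/eqP/rowP => i; rewrite mxE.
by have := x0 i (mem_index_enum i); rewrite /= mulf_eq0 orbb => /eqP.
Qed.

Lemma enorm_gt0 x : (0 < enorm x) = (x != 0).
Proof. by rewrite lt_neqAle eq_sym enorm_eq0 enorm_ge0 andbT. Qed.

Lemma enorm0 : enorm (0 : 'rV[R]_n) = 0.
Proof. by apply/eqP; rewrite enorm_eq0. Qed.

Lemma enormZ a x : enorm (a *: x) = `|a| * enorm x.
Proof.
by rewrite /enorm linearZl_LR linearZr_LR /= mulrA -expr2 sqrtrM ?sqr_ge0 // sqrtr_sqr.
Qed.

Lemma enormN x : enorm (- x) = enorm x.
Proof. by rewrite -scaleN1r enormZ normrN1 mul1r. Qed.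

Lemma enormB x y : enorm (x - y) = enorm (y - x).
Proof. by rewrite -enormN opprB. Qed.

Lemma dot_le_enorm x y : `|dot x y| <= enorm x * enorm y.
Proof.
have [->|x0] := eqVneq x 0; first by rewrite linear0l normr0 mulr_ge0 ?enorm_ge0.
have dx : 0 < dot x x by rewrite -enorm_sqr exprn_gt0 ?enorm_gt0.
rewrite -(@ler_pXn2r _ 2) ?nnegrE ?mulr_ge0 ?enorm_ge0 // exprMn !enorm_sqr.
rewrite real_normK ?num_real //.
have := dot_ge0 (dot x x *: y - dot x y *: x).
rewrite linearBl !linearBr /= !linearZl_LR !linearZr_LR /= (dotC y x).
set a := dot x x; set b := dot x y; set c := dot y y => H.
have : 0 <= a * (a * c - b ^+ 2).
  by apply: le_trans H _; rewrite le_eqVlt; apply/orP; left; apply/eqP; ring.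
by rewrite pmulr_rge0 // subr_ge0.
Qed.

Lemma enorm_triangle x y : enorm (x + y) <= enorm x + enorm y.
Proof.
rewrite -(@ler_pXn2r _ 2) ?nnegrE ?addr_ge0 ?enorm_ge0 //.
rewrite sqrrD !enorm_sqr linearDl !linearDr /= (dotC y x).
by have := le_trans (ler_norm _) (dot_le_enorm x y); lra.
Qed.

Lemma enorm_triangleB x y z : enorm (x - z) <= enorm (x - y) + enorm (y - z).
Proof. by have := enorm_triangle (x - y) (y - z); rewrite addrA subrK. Qed.

Lemma coord_le_enorm x j : `|x 0 j| <= enorm x.
Proof.
rewrite -(@ler_pXn2r _ 2) ?nnegrE ?enorm_ge0 // enorm_sqr real_normK ?num_real //.
rewrite /dot (bigD1 j) //= -expr2 lerDl; apply: sumr_ge0 => i _.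
by rewrite -expr2 sqr_ge0.
Qed.

Lemma enorm_sum (I : Type) (s : seq I) (F : I -> 'rV[R]_n) :
  enorm (\sum_(i <- s) F i) <= \sum_(i <- s) enorm (F i).
Proof.
elim: s => [|i s IH]; first by rewrite !big_nil enorm0.
by rewrite !big_cons (le_trans (enorm_triangle _ _)) // lerD2l.
Qed.

Lemma enorm_delta j : enorm ('e_j : 'rV[R]_n) = 1.
Proof.
rewrite /enorm /dot (bigD1 j) //= !mxE !eqxx mulr1 big1 ?addr0 ?sqrtr1 // => i ij.
by rewrite !mxE (negbTE ij) andbF mulr0.
Qed.

Lemma enorm_le_coord x (c : R) : (forall j, `|x 0 j| <= c) -> enorm x <= n%:R * c.
Proof.
move=> xc; rewrite {1}[x]row_sum_delta (le_trans (enorm_sum _ _)) //.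
have -> : n%:R * c = \sum_(i < n) c by rewrite sumr_const card_ord mulr_natl.
by apply: ler_sum => i _; rewrite enormZ enorm_delta mulr1.
Qed.

Lemma continuous_enorm : continuous (@enorm R n).
Proof.
have cdot : continuous (fun x : 'rV[R]_n => dot x x).
  apply: continuous_big => [|i _ x]; first exact: add_continuous.
  by apply: (@continuousM R _ (fun y : 'rV[R]_n => y 0 i)) => y; exact: coord_continuous.
by move=> x; apply: continuous_comp; [exact: cdot|exact: sqrt_continuous].
Qed.

End enorm.

Section orthoproj.
Variables (R : realType) (n : nat) (V : {vspace 'rV[R]_n}).
Implicit Types x y v : 'rV[R]_n.

Lemma dot_orthoproj x v : v \in V -> dot (orthoproj V x) v = dot x v.
Proof.
by move=> /(orthoprojP V x).2 /eqP; rewrite linearBl subr_eq0 => /eqP.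
Qed.

Lemma orthoproj_unique x y : y \in V ->
  (forall v, v \in V -> dot y v = dot x v) -> orthoproj V x = y.
Proof.
move=> yV xy; have [pV _] := orthoprojP V x.
apply/eqP; rewrite -subr_eq0 -enorm_eq0 -sqrf_eq0 enorm_sqr linearBl /=.
by rewrite dot_orthoproj ?rpredB // xy ?rpredB // subrr.
Qed.

Lemma enorm_orthoproj_le x : enorm (orthoproj V x) <= enorm x.
Proof.
have [->|p0] := eqVneq (enorm (orthoproj V x)) 0; first exact: enorm_ge0.
rewrite -(@ler_pM2r _ (enorm (orthoproj V x))) ?lt_neqAle 1?eq_sym ?p0 ?enorm_ge0 //.
rewrite -expr2 enorm_sqr dot_orthoproj ?(orthoprojP V x).1 //.
exact: le_trans (ler_norm _) (dot_le_enorm _ _).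
Qed.

End orthoproj.

(** Normalize [A] to be the identity on the columns of a minor of maximal
    absolute value: by Cramer's rule, the entries are then quotients of minors
    of [A] by the maximal one. *)
Lemma max_minor_normal_form (F : realFieldType) m n (A : 'M[F]_(m, n)) :
  row_free A -> exists (f : 'I_m -> 'I_n) (B : 'M[F]_m),
    [/\ B \in unitmx, colsub f (B *m A) = 1%:M &
        forall i j, `|(B *m A) i j| <= 1].
Proof.
move=> freeA.
have fullAT : row_full A^T by rewrite /row_full mxrank_tr.
pose f0 := [ffun i => fullrankfun fullAT i].
pose d (f : {ffun 'I_m -> 'I_n}) : F := `|\det (colsub f A)|.
have d0 : d f0 != 0.
  have := fullrowsub_unit fullAT; rewrite unitmxE -det_tr unitfE -normr_eq0.
  congr (`|\det _| != 0); apply/matrixP => i j.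
  by rewrite !mxE [f0 j]ffunE.
pose f := [arg max_(f > f0) d f]%O.
have fmax g : d g <= d f.
  by rewrite /f; case: arg_maxP => // h _; exact.
have df0 : 0 < d f.
  by apply: lt_le_trans (fmax f0); rewrite lt_neqAle eq_sym d0 normr_ge0.
have uf : colsub f A \in unitmx by rewrite unitmxE unitfE -normr_eq0 gt_eqF.
exists f, (invmx (colsub f A)).
have colsubM (g : 'I_m -> 'I_n) C : colsub g (C *m A) = C *m colsub g A.
  by apply/matrixP => i j; rewrite !mxE; apply: eq_bigr => k _; rewrite !mxE.
split; rewrite ?unitmx_inv // ?colsubM ?mulVmx // => i j.
set A' := _ *m A.
pose g := [ffun k => if k == i then j else f k].
have eA : A = colsub f A *m A' by rewrite mulKVmx.
have fA' : colsub f A' = 1%:M by rewrite colsubM mulVmx.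
clearbody A'.
(* Exchanging one column for column [j] multiplies the minor by [A' i j]. *)
have dg : d g = d f * `|A' i j|.
  rewrite /d -normrM; congr `|_|.
  rewrite [in LHS]eA.
  have -> : colsub g (colsub f A *m A') = colsub f A *m colsub g A'.
    by apply/matrixP => k l; rewrite !mxE; apply: eq_bigr => h _; rewrite !mxE.
  rewrite det_mulmx; congr (_ * _).
  have cof k : cofactor (colsub g A') k i = cofactor (1%:M : 'M[F]_m) k i.
    rewrite -fA'; congr (_ * \det _); apply/matrixP => p q.
    by rewrite !mxE ffunE eq_sym (negbTE (neq_lift _ _)).
  have cof1 k : cofactor (1%:M : 'M[F]_m) k i = (i == k)%:R.
    have /matrixP/(_ i k) := mul_mx_adj (1%:M : 'M[F]_m).
    by rewrite mul1mx det1 !mxE.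
  rewrite (expand_det_col _ i) (bigD1 i) //= big1 => [|k ki]; rewrite cof cof1.
    by rewrite addr0 mxE ffunE !eqxx mulr1.
  by rewrite eq_sym (negbTE ki) mulr0.
by have := fmax g; rewrite dg -{2}[d f]mulr1 ler_pM2l.
Qed.

(** Rows of a reduced basis of [V]: the coordinates [f] parametrize [V], with
    distortion bounded independently of [V]. *)
Lemma adapted_basis (R : realType) n m (V : {vspace 'rV[R]_n}) : \dim V = m ->
  exists (f : 'I_m -> 'I_n) (a : 'I_m -> 'rV[R]_n),
    [/\ forall i, a i \in V, forall i j, `|a i 0 j| <= 1,
        forall i k, a i 0 (f k) = (i == k)%:R &
        forall v, v \in V -> v = \sum_i v 0 (f i) *: a i].
Proof.
move=> <-{m}; set m := \dim V.
pose A : 'M[R]_(m, n) := \matrix_(i < m) (vbasis V)`_i.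
have AV (c : 'rV[R]_m) : c *m A = \sum_(i < m) c 0 i *: (vbasis V)`_i.
  by rewrite mulmx_sum_row; apply: eq_bigr => i _; rewrite rowK.
have freeA : row_free A.
  apply: inj_row_free => c; rewrite AV => c0; apply/rowP => i; rewrite mxE.
  by have /freeP /(_ (fun i => c 0 i) c0 i) := basis_free (vbasisP V).
have [f [B [uB fBA BAle]]] := max_minor_normal_form freeA.
exists f, (fun i => row i (B *m A)); split=> [i|i j|i k|v vV].
- rewrite row_mul AV; apply: rpred_sum => j _; apply: rpredZ.
  by apply: vbasis_mem; rewrite mem_nth // size_tuple.
- by rewrite mxE.
- by have /matrixP/(_ i k) := fBA; rewrite !mxE.
pose c : 'rV[R]_m := (\row_i coord (vbasis V) i v) *m invmx B.
have vE : v = c *m (B *m A).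
  rewrite mulmxA mulmxKV // AV [LHS](coord_vbasis vV).
  by apply: eq_bigr => i _; rewrite mxE.
have cE : colsub f v = c.
  rewrite -[RHS]mulmx1 -fBA {1}vE.
  by apply/matrixP => i j; rewrite !mxE; apply: eq_bigr => h _; rewrite !mxE.
rewrite {1}vE mulmx_sum_row; apply: eq_bigr => i _; congr (_ *: _).
by rewrite -cE mxE.
Qed.

Section adapted_basis_bounds.
Variables (R : realType) (n m : nat) (V : {vspace 'rV[R]_n}).
Variables (f : 'I_m -> 'I_n) (a : 'I_m -> 'rV[R]_n).
Hypotheses (aV : forall i, a i \in V) (a1 : forall i j, `|a i 0 j| <= 1).

Lemma adapted_coord_inj :
  (forall i k, a i 0 (f k) = (i == k)%:R) -> injective f.
Proof.
move=> af k l fkl; have := af k l; rewrite -fkl af eqxx.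
by case: eqVneq => // _ /eqP; rewrite oner_eq0.
Qed.

Lemma enorm_adapted_le i : enorm (a i) <= n%:R.
Proof. by rewrite -[n%:R]mulr1 enorm_le_coord. Qed.

(** A vector supported on the adapted coordinates is controlled by its
    projection: its coordinate [f i] is its scalar product with [a i]. *)
Lemma coord_le_orthoproj (af : forall i k, a i 0 (f k) = (i == k)%:R)
    (x : 'rV[R]_n) i : (forall j, j \notin codom f -> x 0 j = 0) ->
  `|x 0 (f i)| <= n%:R * enorm (orthoproj V x).
Proof.
move=> x0.
have -> : x 0 (f i) = dot (orthoproj V x) (a i).
  rewrite dot_orthoproj // /dot (bigD1 (f i)) //= af eqxx mulr1 big1 ?addr0 // => j ji.
  have [/codomP[k jk]|/x0 ->] := boolP (j \in codom f); last by rewrite mul0r.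
  rewrite jk af; case: eqVneq => [ik|]; last by rewrite mulr0.
  by rewrite jk ik eqxx in ji.
rewrite (le_trans (dot_le_enorm _ _)) // mulrC ler_wpM2r ?enorm_ge0 //.
exact: enorm_adapted_le.
Qed.

Lemma enorm_le_adapted_coord (v : 'rV[R]_n) (c : R) :
  (forall v, v \in V -> v = \sum_i v 0 (f i) *: a i) ->
  v \in V -> (forall i, `|v 0 (f i)| <= c) -> enorm v <= (m * n)%:R * c.
Proof.
move=> Va vV vc; rewrite (Va v vV) (le_trans (enorm_sum _ _)) //.
have -> : (m * n)%:R * c = \sum_(i < m) c * n%:R.
  by rewrite sumr_const card_ord natrM -mulr_natl; ring.
apply: ler_sum => i _; rewrite enormZ ler_pM ?enorm_ge0 //.
exact: enorm_adapted_le.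
Qed.

End adapted_basis_bounds.

(** * Subspaces nearly orthogonal to a given vector *)

Section grid.
Variables (R : realType) (n m : nat).

(** The coordinates start at [1], so that no grid point vanishes. *)
Definition grid_point M (z : {ffun 'I_n -> 'I_M}) : 'rV[R]_n :=
  \row_j (z j).+1%:R.

Lemma enorm_grid_point_le M (z : {ffun 'I_n -> 'I_M}) :
  enorm (grid_point z) <= (n * M)%:R.
Proof.
rewrite natrM; apply: enorm_le_coord => j.
by rewrite mxE normr_nat ler_nat.
Qed.

Lemma grid_point_neq0 M (z : {ffun 'I_n -> 'I_M}) :
  (0 < n)%N -> grid_point z != 0.
Proof.
move=> n0; apply/eqP => /rowP/(_ (Ordinal n0)).
by rewrite !mxE => /eqP; rewrite pnatr_eq0.
Qed.

Lemma card_ord_lt M K : (#|[pred i : 'I_M | (i < K)%N]| <= K)%N.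
Proof.
rewrite cardE -(size_map val) -[leqRHS](size_iota 0).
apply: uniq_leq_size => [|_ /mapP[i + ->]].
  by rewrite map_inj_uniq ?enum_uniq //; exact: val_inj.
by rewrite mem_enum inE mem_iota.
Qed.

Lemma eqn_mod_close (a b K : nat) :
  a = b %[mod K] -> `|a%:R - b%:R : R| < K%:R -> a = b.
Proof.
wlog ba : a b / (b <= a)%N.
  move=> H ab abK; have [|/ltnW le_ab] := leqP b a; first by move/H; apply.
  by apply/esym/H; rewrite // distrC.
rewrite -natrB // normr_nat ltr_nat => /eqP; rewrite eqn_mod_dvd // => + lK.
have [d0 _|d0 /(dvdn_leq d0)] := posnP (a - b); last by rewrite leqNgt lK.
by apply/eqP; rewrite eqn_leq ba andbT -subn_eq0 d0.
Qed.

(** Projecting to [V] is injective, with bounded distortion, on [m] suitable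
    coordinates; so the grid points near the orthogonal complement of [V] are
    determined by the remaining coordinates and by the residues modulo [K] of
    those [m] coordinates. *)
Lemma card_grid_slab (V : {vspace 'rV[R]_n}) M K (c : R) :
  \dim V = m -> (0 < K)%N -> n%:R * (c + c) < K%:R ->
  (#|[set z : {ffun 'I_n -> 'I_M} | (enorm (orthoproj V (grid_point z)) <= c)%R]%SET|
    <= K ^ m * M ^ (n - m))%N.
Proof.
move=> dimV K0 cK.
have [f [a [aV a1 af _]]] := adapted_basis dimV.
have finj := adapted_coord_inj af.
set S := [set z | _]%SET.
pose h (z : {ffun 'I_n -> 'I_M}) : {ffun 'I_n -> 'I_M} :=
  [ffun j => if j \in codom f then
     Ordinal (leq_ltn_trans (leq_mod (z j) K) (ltn_ord (z j))) else z j].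
pose F (j : 'I_n) : {pred 'I_M} :=
  if j \in codom f then [pred i : 'I_M | (i < K)%N] else predT.
(* Two points of [S] with the same image under [h] differ by a vector supported
   on the adapted coordinates, whose entries are multiples of [K] and smaller
   than [K]. *)
have hinj : {in S &, injective h}.
  move=> z z' /[!inE] zc z'c hzz'; apply/ffunP => j.
  have hk k : h z k = h z' k by rewrite hzz'.
  pose x := grid_point z - grid_point z' : 'rV[R]_n.
  have xE k : x 0 k = (z k)%:R - (z' k)%:R by rewrite !mxE !mulrSr; ring.
  have x0 k : k \notin codom f -> x 0 k = 0.
    move=> kf; have := hk k.
    by rewrite !ffunE (negbTE kf) /= xE => ->; rewrite subrr.
  move: (hk j); rewrite !ffunE; case: ifPn => [/codomP[i ji]|//].
  move=> /(congr1 val) /= zz'; apply/val_inj/(eqn_mod_close zz').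
  rewrite -xE ji (le_lt_trans (coord_le_orthoproj aV a1 af i x0)) //.
  apply: le_lt_trans cK; rewrite ler_wpM2l // /x linearB /=.
  by rewrite (le_trans (enorm_triangle _ _)) // enormN lerD.
have hF : {subset h @: S <= family F}.
  move=> _ /imsetP[z _ ->]; apply/familyP => j; rewrite ffunE /F.
  by case: ifP => // _; rewrite inE ltn_mod.
rewrite -(card_in_imset hinj).
apply: leq_trans (subset_leq_card (introT fintype.subsetP hF)) _.
rewrite card_family foldrE big_map big_enum /=.
rewrite (bigID (mem (codom f))) /= leq_mul //.
  rewrite (eq_bigr (fun=> #|[pred i : 'I_M | (i < K)%N]|)) => [|j jf]; last by rewrite /F jf.
  rewrite prod_nat_const card_codom // card_ord.
  by case: (m) => // k; rewrite leq_exp2r // card_ord_lt.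
rewrite (eq_bigr (fun=> M)) => [|j jf]; last by rewrite /F (negbTE jf) card_ord.
rewrite prod_nat_const; have := cardC (mem (codom f)).
rewrite card_codom // !card_ord => /(congr1 (subn^~ m)) /=; rewrite addKn.
move=> <-; rewrite leq_eqVlt; apply/orP; left; apply/eqP.
by congr (_ ^ _)%N; apply: eq_card.
Qed.

End grid.

Section isometries.
Variables (R : realType) (n : nat).
Implicit Types (x y v : 'rV[R]_n) (U : 'M[R]_n) (V : {vspace 'rV[R]_n}).

Lemma dotE x y : dot x y = (x *m y^T) 0 0.
Proof. by rewrite mxE; apply: eq_bigr => i _; rewrite mxE. Qed.

Lemma dot_mul_orthogonal U x y :
  U *m U^T = 1%:M -> dot (x *m U) (y *m U) = dot x y.
Proof.
by move=> UU; rewrite !dotE trmx_mul mulmxA -(mulmxA x) UU mulmx1.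
Qed.

Lemma enorm_mul_orthogonal U x :
  U *m U^T = 1%:M -> enorm (x *m U) = enorm x.
Proof. by move=> UU; rewrite /enorm dot_mul_orthogonal. Qed.

(** Take the reflection in the hyperplane bisecting [x] and [y]. *)
Lemma exists_reflection x y : enorm x = enorm y ->
  exists2 U : 'M[R]_n, U *m U^T = 1%:M & x *m U = y.
Proof.
move=> xy; have [->|neq_xy] := eqVneq x y.
  by exists 1%:M; rewrite ?trmx1 mulmx1.
pose v := x - y; pose c := 2 / dot v v.
have v0 : dot v v != 0 by rewrite -enorm_sqr sqrf_eq0 enorm_eq0 subr_eq0.
have vvE : v *m v^T = (dot v v)%:M by rewrite dotE -mx11_scalar.
have xvE : c * dot x v = 1.
  have vv : dot v v = 2 * dot x v.
    have := congr1 (fun t => t ^+ 2) xy; rewrite /= !enorm_sqr /v.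
    by rewrite linearBl !linearBr /= (dotC y x) => ->; ring.
  by rewrite /c mulrAC -vv divff.
have yE : x - v = y by rewrite opprB addrC subrK.
have cE : c * (c * dot v v) = c + c by rewrite /c; field.
clearbody v c.
exists (1%:M - c *: (v^T *m v)).
  have -> : (1%:M - c *: (v^T *m v))^T = 1%:M - c *: (v^T *m v).
    by rewrite linearB /= linearZ /= trmx_mul trmxK trmx1.
  rewrite mulmxBl mul1mx mulmxBr mulmx1 -scalemxAl -scalemxAr.
  rewrite mulmxA -(mulmxA v^T) vvE mul_mx_scalar -scalemxAl !scalerA.
  rewrite cE scalerDl; apply/matrixP => i j; rewrite !mxE; ring.
rewrite mulmxBr mulmx1 -scalemxAr mulmxA.
have -> : x *m v^T = (dot x v)%:M by rewrite dotE -mx11_scalar.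
by rewrite mul_scalar_mx scalerA xvE scale1r.
Qed.

Lemma orthoproj_mul_orthogonal U V x : U *m U^T = 1%:M ->
  orthoproj (linfun (mulmxr U) @: V)%VS (x *m U) = orthoproj V x *m U.
Proof.
move=> UU; have [pV _] := orthoprojP V x.
apply: orthoproj_unique.
  by apply/memv_imgP; exists (orthoproj V x) => //; rewrite lfunE.
move=> _ /memv_imgP[v vV ->]; rewrite lfunE /=.
by rewrite !dot_mul_orthogonal // dot_orthoproj.
Qed.

Lemma dimv_mul_orthogonal U V : U *m U^T = 1%:M ->
  \dim (linfun (mulmxr U) @: V)%VS = \dim V.
Proof.
move=> UU; apply: limg_dim_eq; apply/eqP; rewrite -subv0; apply/subvP => x.
rewrite memv_cap memv_ker lfunE /= memv0 => /andP[_ /eqP xU].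
by rewrite -[x]mulmx1 -UU mulmxA xU mul0mx.
Qed.

Lemma mul_orthogonalK U V : U *m U^T = 1%:M ->
  (linfun (mulmxr U) @: (linfun (mulmxr U^T) @: V))%VS = V.
Proof.
move=> /mulmx1C UU; rewrite -limg_comp; apply/vspaceP => x.
apply/memv_imgP/idP => [[v vV ->]|xV].
  by rewrite comp_lfunE !lfunE /= -mulmxA UU mulmx1.
by exists x => //; rewrite comp_lfunE !lfunE /= -mulmxA UU mulmx1.
Qed.

End isometries.

Lemma closed_measurable_borel (T : ptopologicalType) (A : set (borel T)) :
  closed (A : set T) -> measurable A.
Proof.
move=> /closed_openC oA; rewrite -[A]setCK; apply: measurableC.
exact: sub_sigma_algebra.
Qed.

Section slab.
Variables (R : realType) (n m : nat) (le_mn : (m <= n)%N).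
Local Notation G := (grassmannian R le_mn).

Definition slab (x : 'rV[R]_n) (c : R) : set (borel G) :=
  [set V | enorm (orthoproj (val (V : G)) x) <= c].

Lemma continuous_enorm_mulmx (x : 'rV[R]_n) :
  continuous (fun M : 'M[R]_n => enorm (x *m M)).
Proof.
have cdot : continuous (fun M : 'M[R]_n => dot (x *m M) (x *m M)).
  have -> : (fun M : 'M[R]_n => dot (x *m M) (x *m M)) =
      (fun M => \sum_(j < n) (\sum_(i < n) x 0 i * M i j) * (\sum_(i < n) x 0 i * M i j)).
    by apply/funext => M; apply: eq_bigr => j _; rewrite mxE.
  apply: continuous_big => [|j _]; first exact: add_continuous.
  have cj : continuous (fun M : 'M[R]_n => \sum_(i < n) x 0 i * M i j).
    apply: continuous_big => [|i _ M]; first exact: add_continuous.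
    apply: (@continuousM R _ (fun=> x 0 i) (fun M : 'M[R]_n => M i j)).
      exact: cst_continuous.
    exact: coord_continuous.
  by move=> M; apply: continuousM; exact: cj.
move=> M; apply: (@continuous_comp _ _ _ (fun M : 'M[R]_n => dot (x *m M) (x *m M))).
  exact: cdot.
exact: sqrt_continuous.
Qed.

Lemma continuous_enorm_orthoproj (x : 'rV[R]_n) :
  continuous (fun V : G => enorm (orthoproj (val V) x)).
Proof.
move=> V.
have -> : (fun V : G => enorm (orthoproj (val V) x)) =
    (fun M : 'M[R]_n => enorm (x *m M)) \o @projmx R n m le_mn.
  by apply/funext => W /=; rewrite /projmx mul_rV_lin1.
apply: continuous_comp; first exact: initial_continuous.
exact: continuous_enorm_mulmx.
Qed.

Lemma measurable_slab x c : measurable (slab x c).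
Proof.
apply: closed_measurable_borel.
by have /continuous_closedP/(_ _ (@closed_le _ c)) := @continuous_enorm_orthoproj x.
Qed.

Variable gamma : probability (borel G) R.
Hypothesis gamma_inv : orthogonal_invariant gamma.

Lemma gamma_slab_mul_orthogonal (U : 'M[R]_n) x c : U *m U^T = 1%:M ->
  gamma (slab (x *m U) c) = gamma (slab x c).
Proof.
move=> UU; rewrite -(gamma_inv UU (measurable_slab x c)); congr (gamma _).
have UU' : U^T *m U^T^T = 1%:M by rewrite trmxK; exact: mulmx1C.
apply/seteqP; split=> [W Wc|W [V Vc WE]] /=; last first.
  by rewrite /slab /= WE orthoproj_mul_orthogonal // enorm_mul_orthogonal.
have dimW : \dim (linfun (mulmxr U^T) @: val (W : G))%VS == m.
  by rewrite dimv_mul_orthogonal // (valP (W : G)).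
exists (exist _ (linfun (mulmxr U^T) @: val (W : G))%VS dimW : G).
  rewrite /slab /= -[x]mulmx1 -UU mulmxA orthoproj_mul_orthogonal //.
  by rewrite enorm_mul_orthogonal.
by rewrite /= mul_orthogonalK.
Qed.

(** Isometries act transitively on directions, and scaling [x] and [c] together
    leaves [slab x c] unchanged. *)
Lemma gamma_slab_const x y d : x != 0 -> y != 0 ->
  gamma (slab x (d * enorm x)) = gamma (slab y (d * enorm y)).
Proof.
rewrite -!enorm_gt0 => x0 y0; pose k := enorm x / enorm y.
have k0 : 0 < k by rewrite divr_gt0.
have [|U UU yU] := @exists_reflection _ _ x (k *: y).
  by rewrite enormZ gtr0_norm // divfK // gt_eqF.
rewrite -(gamma_slab_mul_orthogonal _ _ UU) yU; congr (gamma _).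
have kE : d * enorm x = k * (d * enorm y) by rewrite mulrCA divfK // gt_eqF.
apply/seteqP; split => W; rewrite /slab /= linearZ /= enormZ gtr0_norm //;
  by rewrite kE ler_pM2l.
Qed.

(** The key estimate. By invariance the left-hand side can be averaged over
    the directions of any finite family of vectors; the points of a grid of
    mesh comparable to [d] are spread evenly enough for a proportion of order
    [d ^+ m] of them to be nearly orthogonal to any given subspace. *)
Lemma gamma_slab_le x d : (0 < n)%N -> x != 0 -> 0 < d <= 1 ->
  (gamma (slab x (d * enorm x)) <= (((4 * n ^ 2).+1%:R * d) ^+ m)%:E)%E.
Proof.
move=> n0 x0 /andP[d0 d1].
(* [d * M] lies between [1] and [2], which determines [K] through [cK]. *)
pose M := (Num.truncn d^-1).+1; pose K := (4 * n ^ 2).+1.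
have dI : 0 <= d^-1 by rewrite invr_ge0 ltW.
have /andP[Md dM'] := truncn_itv dI.
have dM : 1 <= d * M%:R by rewrite mulrC -ler_pdivrMr // mul1r ltW.
have dM2 : d * M%:R <= 2.
  rewrite mulrC -ler_pdivlMr // /M -natr1.
  have d1' : 1 <= d^-1 by rewrite invf_ge1.
  by rewrite mulrDl !mul1r lerD.
pose c := d * (n * M)%:R.
pose I := {ffun 'I_n -> 'I_M}.
have cK : n%:R * (c + c) < K%:R :> R.
  apply: (@le_lt_trans _ _ (4 * n ^ 2)%:R); last by rewrite ltr_nat.
  have -> : n%:R * (c + c) = 2 * (n ^ 2)%:R * (d * M%:R) :> R.
    by rewrite /c natrM natrX; ring.
  have -> : (4 * n ^ 2)%:R = 2 * (n ^ 2)%:R * 2 :> R by rewrite natrM; ring.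
  by rewrite ler_wpM2l // mulr_ge0.
have cardI : #|I| = (M ^ n)%N by rewrite card_ffun !card_ord.
pose A (z : I) := slab (grid_point R z) (d * enorm (grid_point R z)).
have mA z : measurable (A z) by exact: measurable_slab.
have Agamma z : gamma (A z) = gamma (slab x (d * enorm x)).
  by apply: gamma_slab_const => //; exact: grid_point_neq0.
have : (\sum_(z : I) gamma (A z) <= (K ^ m * M ^ (n - m))%:R%:E)%E.
  rewrite (eq_bigr (fun z => \int[gamma]_V (\1_(A z) V)%:E)%E); last first.
    by move=> z _; rewrite integral_indic // setIT.
  rewrite -ge0_integral_sum //; last first.

    by move=> z; apply/measurable_EFinP; exact: measurable_indic.
  apply: (@le_trans _ _ (\int[gamma]_V (cst (K ^ m * M ^ (n - m))%:R%:E V))%E).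
    apply: ge0_le_integral => //.
    - by move=> V _; apply: sume_ge0 => z _; rewrite lee_fin.
    - apply: emeasurable_sum => z; apply/measurable_EFinP.
      exact: measurable_indic.
    move=> V _; rewrite sumEFin lee_fin.
    have := @card_grid_slab R n m (val (V : G)) M K c (eqP (valP (V : G))) isT cK.
    rewrite -(ler_nat R); apply: le_trans.
    rewrite -sum1_card natr_sum [leRHS]big_mkcond /=; apply: ler_sum => z _.
    rewrite indicE inE; case: ifPn => [_|zS]; first by case: (_ \in _).
    rewrite (_ : (_ \in _) = false) //; apply: contraNF zS; rewrite inE /A /slab /=.
    move=> /le_trans; apply; rewrite /c ler_wpM2l ?(ltW d0) //.
    exact: enorm_grid_point_le.
  rewrite integral_cst // [X in (_ * X <= _)%E](_ : _ = 1%E) ?mule1 //.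
  exact: (probability_setT gamma).
rewrite (eq_bigr (fun=> gamma (slab x (d * enorm x)))) => [|z _]; last by rewrite Agamma.
have [g gE] : exists g : R, gamma (slab x (d * enorm x)) = g%:E.
  exists (fine (gamma (slab x (d * enorm x)))).
  by rewrite fineK // fin_num_measure //; exact: measurable_slab.
rewrite gE sumEFin sumr_const cardI !lee_fin -(mulr_natl g) => gle.
have M0 : 0 < M%:R :> R by rewrite ltr0n.
have : g <= (K%:R / M%:R) ^+ m.
  have Mn : 0 < (M ^ n)%:R :> R by rewrite ltr0n expn_gt0.
  rewrite -(ler_pM2l Mn) (le_trans gle) //.
  have -> : (M ^ n = M ^ m * M ^ (n - m))%N by rewrite -expnD subnKC.
  rewrite !natrM !natrX expr_div_n mulrAC mulrCA mulfV ?mulr1 //.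
  by rewrite expf_neq0 // gt_eqF.
move/le_trans; apply; rewrite lerXn2r ?nnegrE ?divr_ge0 ?mulr_ge0 ?(ltW d0) //.
rewrite ler_wpM2l // -[leLHS]mul1r ler_pdivrMr //.
Qed.

End slab.

(** * Energies and finitely supported measures *)

Lemma continuous_measurable_borel (R : realType) (T : ptopologicalType) (f : T -> R) :
  continuous f -> measurable_fun [set: borel T] (f : borel T -> R).
Proof.
move=> /continuousP cf mD; apply: (measurability _ (RGenOpens.measurableE R)) => //.
move=> _ [_ [a [b ->] <-]]; rewrite setTI; apply: sub_sigma_algebra.
by apply: cf; exact: interval_open.
Qed.

Section phi.
Variables (R : realType) (n m : nat).
Implicit Types (x y : 'rV[R]_n) (r k : R).

(** A form of [phi] whose monotonicity in [r] and [enorm x] is apparent. *)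
Lemma phi_natE r x : 0 < r ->
  phi r m%:R x = (r / Num.max r (enorm x)) ^+ m.
Proof.
move=> r0; rewrite /phi; case: eqVneq => [->|x0].
  by rewrite enorm0 max_l ?ltW // divff ?expr1n // gt_eqF.
have x0' : 0 < enorm x by rewrite enorm_gt0.
rewrite powR_mulrn ?divr_ge0 ?ltW //.
have [xr|xr] := leP (enorm x) r.
  by rewrite divff ?gt_eqF // expr1n min_l // exprn_ege1 // ler_pdivlMr // mul1r.
by rewrite min_r // exprn_ile1 ?divr_ge0 ?ltW // ltr_pdivrMr // mul1r.
Qed.

Lemma phi_ge0 r x : 0 < r -> 0 <= phi r m%:R x.
Proof.
move=> r0; rewrite phi_natE // exprn_ge0 // divr_ge0 ?(ltW r0) // le_max.
by rewrite (ltW r0).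
Qed.

Lemma phi_le r r' k x x' : 0 < r -> 0 < r' ->
  r * Num.max r' (enorm x') <= k * r' * Num.max r (enorm x) ->
  phi r m%:R x <= k ^+ m * phi r' m%:R x'.
Proof.
move=> r0 r'0 le; rewrite !phi_natE // -exprMn.
have m0 : 0 < Num.max r (enorm x) by rewrite lt_max r0.
have m'0 : 0 < Num.max r' (enorm x') by rewrite lt_max r'0.
have H : r / Num.max r (enorm x) <= k * (r' / Num.max r' (enorm x')).
  by rewrite ler_pdivrMr // mulrA mulrAC ler_pdivlMr.
have H0 : 0 <= r / Num.max r (enorm x) by rewrite divr_ge0 ?ltW.
by apply: lerXn2r; rewrite ?nnegrE ?(le_trans H0 H).
Qed.

Lemma phi_refl r x : 0 < r -> phi r m%:R (x - x) = 1.
Proof. by rewrite subrr /phi eqxx. Qed.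

Lemma continuous_phi r x : 0 < r ->
  continuous (fun y : 'rV[R]_n => phi r m%:R (x - y)).
Proof.
move=> r0.
have -> : (fun y : 'rV[R]_n => phi r m%:R (x - y)) =
    (fun y => (r / Num.max r (enorm (x - y))) ^+ m).
  by apply/funext => y; rewrite phi_natE.
have c : continuous (fun y : 'rV[R]_n => enorm (x - y)).
  move=> y; apply: (@continuous_comp _ _ _ (fun y : 'rV[R]_n => x - y)).
    exact: (@cvgB _ 'rV[R]_n _ (nbhs y) _ (fun=> x) id x y (cvg_cst x) (@cvg_id _ (nbhs y))).
  exact: continuous_enorm.
move=> y; apply: (@continuous_comp _ _ _
  (fun y : 'rV[R]_n => r / Num.max r (enorm (x - y))) (fun t => t ^+ m)); last first.
  exact: exprn_continuous.
apply: continuousM; first exact: cst_continuous.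
apply: continuousV; first by rewrite gt_eqF // lt_max r0.
by apply: continuous_max; [exact: cst_continuous|exact: c].
Qed.

Lemma phi_sym r x y : 0 < r -> phi r m%:R (x - y) = phi r m%:R (y - x).
Proof. by move=> r0; rewrite !phi_natE // enormB. Qed.

End phi.

Section integral_blocks.
Local Open Scope ereal_scope.
Context d (T : measurableType d) (R : realType) (mu : {measure set T -> \bar R}).

(** The integral of a nonnegative function is a supremum over the simple
    functions below it, so that monotonicity holds for all such functions. *)
Lemma ge0_le_integralT (f g : T -> \bar R) :
  (forall x, 0 <= f x) -> (forall x, f x <= g x) ->
  \int[mu]_x f x <= \int[mu]_x g x.
Proof.
move=> f0 fg; have g0 x : 0 <= g x := le_trans (f0 x) (fg x).
rewrite !ge0_integralTE //; apply: le_ereal_sup => _ [h hf <-].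
by exists h => // x; exact: le_trans (hf x) (fg x).
Qed.

Variables (N : nat) (P : nat -> set T).
Hypotheses (mP : forall i, measurable (P i)) (tP : trivIset setT P).

Lemma sum_le_integral (f : T -> \bar R) (c : nat -> R) :
  (forall x, 0 <= f x) -> (forall i, (0 <= c i)%R) ->
  (forall i x, (i < N)%N -> P i x -> (c i)%:E <= f x) ->
  \sum_(i < N) (c i)%:E * mu (P i) <= \int[mu]_x f x.
Proof.
move=> f0 c0 cf.
rewrite (eq_bigr (fun i : 'I_N => \int[mu]_x ((c i)%:E * (\1_(P i) x)%:E))); last first.
  move=> i _; rewrite ge0_integralZl ?lee_fin //; last first.
    by apply/measurable_EFinP; exact: measurable_indic.
  by rewrite integral_indic // setIT.
have ci0 (i : 'I_N) x : 0 <= (c i)%:E * (\1_(P i) x)%:E.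
  by rewrite mule_ge0 // lee_fin.
rewrite -ge0_integral_sum //; last first.
  move=> i; apply: emeasurable_funM => //.
  by apply/measurable_EFinP; exact: measurable_indic.
apply: ge0_le_integralT => x; first exact: sume_ge0.
have [[i Pix]|nP] := pselect (exists i : 'I_N, P i x); last first.
  rewrite big1 // => i _; rewrite indicE memNset ?mule0 // => Pix.
  by apply: nP; exists i.
rewrite (bigD1 i) //= big1 ?adde0 => [|j ji].
  by rewrite indicE mem_set // mule1 cf.
rewrite indicE memNset ?mule0 // => Pjx.
have /val_inj e := tP I I (ex_intro _ x (conj Pjx Pix)).
by rewrite e eqxx in ji.
Qed.

End integral_blocks.

Lemma sum_le_double_integral d (T : measurableType d) (R : realType)
    (mu : probability T R) N (P : nat -> set T) (k : T -> T -> R) (c : nat -> nat -> R) :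
  (forall i, measurable (P i)) -> trivIset setT P ->
  (forall x y, 0 <= k x y) -> (forall i j, 0 <= c i j) ->
  (forall i j x y, (i < N)%N -> (j < N)%N -> P i x -> P j y -> c i j <= k x y) ->
  ((\sum_(i < N) \sum_(j < N) fine (mu (P i)) * fine (mu (P j)) * c i j)%:E
    <= \int[mu]_x \int[mu]_y (k x y)%:E)%E.
Proof.
move=> mP tP k0 c0 ck; pose w i := fine (mu (P i)).
have wE i : mu (P i) = (w i)%:E by rewrite fineK // fin_num_measure.
have w0 i : 0 <= w i by rewrite fine_ge0 ?measure_ge0.
pose b i := \sum_(j < N) c i j * w j.
have b0 i : 0 <= b i by apply: sumr_ge0 => j _; rewrite mulr_ge0.
have kint0 x : (0 <= \int[mu]_y (k x y)%:E)%E.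
  by apply: integral_ge0 => y _; rewrite lee_fin.
have inner i x : (i < N)%N -> P i x -> ((b i)%:E <= \int[mu]_y (k x y)%:E)%E.
  move=> iN Px; rewrite /b -sumEFin.
  under eq_bigr do rewrite EFinM -wE.
  apply: (@sum_le_integral _ _ _ mu N P mP tP _ (c i)) => [y|j|j y jN Py]; rewrite ?lee_fin //.
  exact: ck.
apply: le_trans (@sum_le_integral _ _ _ mu N P mP tP _ b kint0 b0 inner).
rewrite [leRHS](eq_bigr (fun i : 'I_N => (b i * w i)%:E)) => [|i _]; last first.
  by rewrite EFinM; congr (_ * _)%E; exact: wE.
rewrite sumEFin lee_fin le_eqVlt; apply/orP; left; apply/eqP.
apply: eq_bigr => i _; rewrite /b mulr_suml.
by apply: eq_bigr => j _; rewrite -/(w i) -/(w j); ring.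
Qed.

Section nets.
Variables (R : realType) (n : nat).
Implicit Types (E : set 'rV[R]_n) (x y : 'rV[R]_n) (r : R).

Lemma open_enorm_ball x r : open [set y : 'rV[R]_n | enorm (y - x) < r].
Proof.
have c : continuous (fun y : 'rV[R]_n => enorm (y - x)).
  move=> y; apply: (@continuous_comp _ _ _ (fun y : 'rV[R]_n => y - x)).
    exact: (@cvgB _ 'rV[R]_n _ (nbhs y) _ id (fun=> x) y x (@cvg_id _ (nbhs y)) (cvg_cst x)).
  exact: continuous_enorm.
by have /continuousP/(_ _ (@open_lt _ r)) := c.
Qed.

Lemma compact_net E r : compact E -> 0 < r ->
  exists s : seq 'rV[R]_n, (forall x, x \in s -> E x) /\
    (forall y, E y -> exists2 x, x \in s & enorm (y - x) < r).
Proof.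
rewrite compact_cover => cE r0.
have [|y Ey|D DE DcE] := cE _ E (fun x => [set y | enorm (y - x) < r]).
- by move=> x _; exact: open_enorm_ball.
- by exists y => //=; rewrite subrr enorm0.
exists (finmap.enum_fset D); split=> [x xD|y /DcE [x xD yx]].
  by have := DE x xD; rewrite inE.
by exists x.
Qed.

Lemma measurable_compact E : compact E -> measurable (E : set (borel 'rV[R]_n)).
Proof.
move=> cE; apply: closed_measurable_borel; apply: compact_closed cE.
exact: norm_hausdorff.
Qed.

Variable m : nat.

(** Up to the factor [3 ^+ m], the energy of a measure on [E] is at least that
    of a finitely supported one, because [phi] varies little over pieces of
    diameter comparable to [r]. *)
Lemma energy_ge_discrete E r (mu : probability (borel 'rV[R]_n) R) :
  compact E -> 0 < r -> probabilities_on E mu ->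
  exists N (x : 'I_N -> 'rV[R]_n) (w : 'I_N -> R),
    [/\ forall i, E (x i), forall i, 0 <= w i, \sum_i w i = 1 &
     ((\sum_i \sum_j w i * w j * phi r m%:R (x i - x j))%:E
       <= (3 ^+ m)%:E * energy r m%:R mu)%E].
Proof.
move=> cE r0 muE.
have [s [sE Es]] := compact_net cE r0.
pose B i : set (borel 'rV[R]_n) := E `&` [set y | enorm (y - s`_i) < r].
have mB i : measurable (B i).
  apply: measurableI; first exact: measurable_compact.
  by apply: sub_sigma_algebra; exact: open_enorm_ball.
pose N := size s; pose P := seqDU B.
have mP i : measurable (P i) by exact: seqDU_measurable.
have tP : trivIset setT P by exact: trivIset_seqDU.
exists N, (fun i => s`_i), (fun i => fine (mu (P i))).
split=> [i|i||]; first by apply: sE; rewrite mem_nth.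
- by rewrite fine_ge0 ?measure_ge0.
- have EU : E = \big[setU/set0]_(i < N) P i.
    rewrite -bigsetU_seqDU -bigcup_mkord; apply/seteqP; split=> [y Ey|y [i _ []//]].
    have [x xs yx] := Es y Ey; exists (index x s); rewrite /= ?index_mem //.
    by split=> //=; rewrite nth_index.
  have := muE; rewrite /probabilities_on /= {1}EU measure_bigsetU //.
  have -> : (\sum_(i < N) mu (P i) = (\sum_(i < N) fine (mu (P i)))%:E)%E.
    by rewrite -sumEFin; apply: eq_bigr => i _; rewrite fineK // fin_num_measure.
  by case.
pose c i j := (3 ^+ m)^-1 * phi r m%:R (s`_i - s`_j).
have c0 i j : 0 <= c i j by rewrite mulr_ge0 ?invr_ge0 ?exprn_ge0 ?phi_ge0.
have m3 : 0 < 3 ^+ m :> R by rewrite exprn_gt0.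
have := @sum_le_double_integral _ _ _ mu N P
  (fun x y => phi r m%:R ((x : 'rV[R]_n) - (y : 'rV[R]_n))) c mP tP.
move=> /(_ (fun x y => phi_ge0 m ((x : 'rV[R]_n) - (y : 'rV[R]_n)) r0) c0) H.
have {H} : ((3 ^+ m)%:E * (\sum_(i < N) \sum_(j < N)
    fine (mu (P i)) * fine (mu (P j)) * c i j)%:E <= (3 ^+ m)%:E * energy r m%:R mu)%E.
  rewrite lee_pmul2l ?lte_fin //; apply: H => i j x y _ _.
  move=> Px Py; have [_ /= xi] := @subset_seqDU _ B i x Px.
  have [_ /= yj] := @subset_seqDU _ B j y Py.
  rewrite /c ler_pdivrMl //; apply: phi_le => //.
  rewrite [3 * r]mulrC -mulrA ler_pM2l // ge_max.
  have rM : r <= Num.max r (enorm (s`_i - s`_j)) by rewrite le_max lexx.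
  have sM : enorm (s`_i - s`_j) <= Num.max r (enorm (s`_i - s`_j)).
    by rewrite le_max lexx orbT.
  have := enorm_triangleB x s`_i y; have := enorm_triangleB s`_i s`_j y.
  rewrite (enormB s`_j y); move: xi yj rM sM r0; set M := Num.max _ _.
  by move=> *; apply/andP; split; lra.
apply: le_trans; rewrite -EFinM lee_fin mulr_sumr ler_sum // => i _.
rewrite mulr_sumr ler_sum // => j _.
by rewrite /c mulrCA mulVKf // gt_eqF.
Qed.


End nets.

Section uniform_measure.
Context d (T : measurableType d) (R : realType) (N : nat) (x : nat -> T).

Let NV_ge0 : 0 <= N.+1%:R^-1 :> R. Proof. by rewrite invr_ge0. Qed.

Definition uniform_on : set T -> \bar R :=
  mscale (NngNum NV_ge0) (msum (fun k => \d_(x k)) N.+1).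

HB.instance Definition _ := Measure.on uniform_on.

Lemma uniform_on_eq1 (A : set T) : (forall k, (k <= N)%N -> A (x k)) ->
  uniform_on A = 1%E.
Proof.
move=> Ax; rewrite /uniform_on /mscale /= /msum.
rewrite (eq_bigr (fun=> 1%E)) => [|i _]; last first.
  by rewrite /= diracE mem_set //; apply: Ax; rewrite -ltnS.
by rewrite sumEFin -EFinM sumr_const card_ord mulVf // pnatr_eq0.
Qed.

HB.instance Definition _ := Measure_isProbability.Build _ _ _ uniform_on
  (@uniform_on_eq1 setT (fun _ _ => Logic.I)).

Lemma integral_uniform_on (f : T -> R) : (forall y, 0 <= f y) ->
  measurable_fun setT f ->
  (\int[uniform_on]_y (f y)%:E = (N.+1%:R^-1 * \sum_(k < N.+1) f (x k))%:E)%E.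
Proof.
move=> f0 mf; have mEf : measurable_fun setT (EFin \o f) by exact/measurable_EFinP.
have f0' (y : T) : setT y -> (0 <= (f y)%:E)%E by rewrite lee_fin.
rewrite /uniform_on ge0_integral_mscale // ge0_integral_measure_sum // EFinM.
congr (_ * _)%E; rewrite -sumEFin; apply: eq_bigr => i _.
by rewrite integral_dirac // diracT mul1e.
Qed.

End uniform_measure.


Section inf_energy.
Variables (R : realType) (n m : nat).
Implicit Types (E : set 'rV[R]_n) (r : R).

Definition inf_energy r E : R :=
  fine (ereal_inf (energy r m%:R @` probabilities_on E)).

Lemma energy_uniform_on r N (x : nat -> borel 'rV[R]_n) : 0 < r ->
  energy r m%:R (uniform_on R N x) =
  (N.+1%:R^-1 ^+ 2 * \sum_(i < N.+1) \sum_(j < N.+1)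
     phi r m%:R ((x i : 'rV[R]_n) - (x j : 'rV[R]_n)))%:E.
Proof.
move=> r0; rewrite /energy.
have inner (z : borel 'rV[R]_n) :
    (\int[uniform_on R N x]_y (phi r m%:R ((z : 'rV[R]_n) - (y : 'rV[R]_n)))%:E =
    (N.+1%:R^-1 * \sum_(j < N.+1) phi r m%:R ((z : 'rV[R]_n) - (x j : 'rV[R]_n)))%:E)%E.
  apply: integral_uniform_on => [y|]; first exact: phi_ge0.
  by apply: continuous_measurable_borel; exact: continuous_phi.
under eq_integral do rewrite inner.
rewrite integral_uniform_on /=; first last.
- have c j : continuous (fun y : 'rV[R]_n => phi r m%:R (y - (x j : 'rV[R]_n))).
    under eq_fun do rewrite phi_sym //.
    exact: continuous_phi.
  apply: measurable_funM; first exact: measurable_cst.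
  apply: measurable_sum => j; apply: continuous_measurable_borel; exact: c.
- by move=> y; rewrite mulr_ge0 ?invr_ge0 // sumr_ge0 // => j _; exact: phi_ge0.
by rewrite -mulr_sumr mulrA -expr2.
Qed.

Variable E : set 'rV[R]_n.
Hypotheses (E0 : E !=set0) (cE : compact E).

Lemma compact_enorm_bounded : exists2 B : R, 0 < B & forall x, E x -> enorm x <= B.
Proof.
have [M [_ HM]] := compact_bounded cE.
have M1 : M < `|M| + 1 by rewrite (le_lt_trans (ler_norm M)) // ltrDl.
exists (n%:R * (`|M| + 1) + 1) => [|x Ex].
  by rewrite ltr_wpDl // mulr_ge0 // addr_ge0.
rewrite ler_wpDr //; apply: enorm_le_coord => j.
apply: le_trans (HM _ M1 x Ex).
rewrite [leRHS]/Num.norm /= mx_normrE.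
by apply/bigmax_geP; right => /=; exists (0, j).
Qed.

Lemma ereal_inf_energy_le1 r : 0 < r ->
  (ereal_inf (energy r m%:R @` probabilities_on E) <= 1)%E.
Proof.
move=> r0; have [e Ee] := E0.
apply: le_trans (_ : energy r m%:R (uniform_on R 0 (fun=> e : borel 'rV[R]_n)) <= _)%E.
  apply: ereal_inf_lbound; exists (uniform_on R 0 (fun=> e : borel 'rV[R]_n)) => //.
  by rewrite /probabilities_on /=; apply: uniform_on_eq1.
by rewrite energy_uniform_on // !big_ord1 phi_refl // invr1 expr1n mulr1.
Qed.

(** On the bounded set [E], [phi] is bounded below by the positive number [d]. *)
Lemma ereal_inf_energy_gt0 r : 0 < r ->
  (0 < ereal_inf (energy r m%:R @` probabilities_on E))%E.
Proof.
move=> r0; have [B B0 EB] := compact_enorm_bounded.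
pose d := (r / Num.max r (B + B)) ^+ m.
have M0 : 0 < Num.max r (B + B) by rewrite lt_max r0.
have d0 : 0 < d by rewrite exprn_gt0 // divr_gt0.
have m3 : 0 < 3 ^+ m :> R by rewrite exprn_gt0.
apply: (@lt_le_trans _ _ (d / 3 ^+ m)%:E); first by rewrite lte_fin divr_gt0.
apply: le_ereal_inf_tmp => _ [mu muE <-].
have [N [x [w [xE w0 w1 le]]]] := energy_ge_discrete m cE r0 muE.
rewrite -(@lee_pmul2l _ (3 ^+ m)%:E) ?lte_fin //.
apply: le_trans le; rewrite -EFinM lee_fin mulrCA mulfV ?gt_eqF // mulr1.
have -> : d = \sum_i \sum_j w i * w j * d.
  rewrite -[LHS]mul1r -[X in X * _]mulr1 -{1}w1 -{1}w1.
  rewrite mulr_suml mulr_suml; apply: eq_bigr => i _.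
  by rewrite mulr_sumr mulr_suml.
apply: ler_sum => i _; apply: ler_sum => j _; rewrite ler_wpM2l ?mulr_ge0 //.
rewrite phi_natE //; apply: lerXn2r; rewrite ?nnegrE ?divr_ge0 ?(ltW r0) //.
- by rewrite le_max (ltW r0).
- by rewrite le_max (ltW r0).
rewrite ler_pM2l // lef_pV2 ?posrE // ?lt_max ?r0 // ge_max le_max lexx /= le_max.
apply/orP; right; apply: le_trans (enorm_triangle _ _) _.
by rewrite enormN lerD // EB.
Qed.

Lemma inf_energyE r : 0 < r ->
  ereal_inf (energy r m%:R @` probabilities_on E) = (inf_energy r E)%:E.
Proof.
move=> r0; rewrite fineK // fin_numElt (lt_trans _ (ereal_inf_energy_gt0 r0)) //=.
exact: le_lt_trans (ereal_inf_energy_le1 r0) (ltry 1).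
Qed.

Lemma inf_energy_gt0 r : 0 < r -> 0 < inf_energy r E.
Proof. by move=> r0; rewrite -lte_fin -inf_energyE // ereal_inf_energy_gt0. Qed.

Lemma capacityE r : 0 < r -> capacity r m%:R E = ((inf_energy r E)^-1)%:E.
Proof. by move=> r0; rewrite /capacity inf_energyE // inver gt_eqF ?inf_energy_gt0. Qed.

Lemma inf_energy_le_uniform r N (x : nat -> 'rV[R]_n) : 0 < r ->
  (forall k, (k <= N)%N -> E (x k)) ->
  inf_energy r E <= N.+1%:R^-1 ^+ 2 *
    \sum_(i < N.+1) \sum_(j < N.+1) phi r m%:R (x i - x j).
Proof.
move=> r0 xE; rewrite -lee_fin -inf_energyE // -(energy_uniform_on _ x) //.
apply: ereal_inf_lbound; exists (uniform_on R N (x : nat -> borel 'rV[R]_n)) => //.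
by rewrite /probabilities_on /=; apply: uniform_on_eq1.
Qed.

Lemma le_inf_energy r r' : 0 < r -> r <= r' -> inf_energy r E <= inf_energy r' E.
Proof.
move=> r0 rr'; have r'0 := lt_le_trans r0 rr'.
have H (a b : \bar R) (c d : R) : a = c%:E -> b = d%:E -> (a <= b)%E -> c <= d.
  by move=> -> ->; rewrite lee_fin.
apply: H (inf_energyE r0) (inf_energyE r'0) _.
apply: le_ereal_inf_tmp => _ [mu muE <-].
apply: le_trans (_ : energy r m%:R mu <= _)%E.
  by apply: ereal_inf_lbound; exists mu.
apply: ge0_le_integralT => x.
  by apply: integral_ge0 => y _; rewrite lee_fin phi_ge0.
apply: ge0_le_integralT => y; rewrite lee_fin ?phi_ge0 //.
have := @phi_le _ _ m r r' 1 (x - y) (x - y) r0 r'0.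
rewrite expr1n !mul1r; apply; set e := enorm _.
have [er|er] := leP e r; first by rewrite max_l ?(le_trans er) // mulrC.
have [_|_] := leP r' e; first by rewrite ler_wpM2r ?enorm_ge0.
by rewrite mulrC ler_wpM2l ?ltW.
Qed.

(** A near-minimizer of the energy, made finitely supported. *)
Lemma exists_discrete_inf_energy r : 0 < r ->
  exists N (x : 'I_N -> 'rV[R]_n) (w : 'I_N -> R),
    [/\ forall i, E (x i), forall i, 0 <= w i, \sum_i w i = 1 &
     \sum_i \sum_j w i * w j * phi r m%:R (x i - x j)
       <= 2 * 3 ^+ m * inf_energy r E].
Proof.
move=> r0; have I0 := inf_energy_gt0 r0.
have Ifin : ereal_inf (energy r m%:R @` probabilities_on E) \is a fin_num.
  by rewrite inf_energyE.
have [_ [mu muE <-] le] := lb_ereal_inf_adherent I0 Ifin.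
have [N [x [w [xE w0 w1 wle]]]] := energy_ge_discrete m cE r0 muE.
exists N, x, w; split => //; rewrite -lee_fin; apply: le_trans wle _.
have -> : ((2 * 3 ^+ m * inf_energy r E)%:E =
    (3 ^+ m)%:E * (inf_energy r E + inf_energy r E)%:E)%E.
  by rewrite -EFinM; congr (_%:E); ring.
by rewrite lee_pmul2l ?lte_fin ?exprn_gt0 // EFinD -{1}inf_energyE // ltW.
Qed.

End inf_energy.

(** * Coverings of projections *)

Section harmonic.
Variable R : realType.

Lemma harmonic_sum_le (M : nat) :
  \sum_(0 <= t < M.+1) (t.+1%:R : R)^-1 <= 1 + ln M.+1%:R.
Proof.
elim: M => [|M IH]; first by rewrite big_nat1 invr1 ln1 addr0.
rewrite big_nat_recr //= (le_trans (lerD IH (lexx _))) // -addrA lerD2l.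
have M1 : 0 < M.+1%:R :> R by rewrite ltr0n.
have M2 : 0 < M.+2%:R :> R by rewrite ltr0n.
have : ln (M.+1%:R / M.+2%:R) <= M.+1%:R / M.+2%:R - 1 :> R.
  have := @le_ln1Dx R (M.+1%:R / M.+2%:R - 1); rewrite addrCA subrr addr0; apply.
  by rewrite ltrBrDl subrr divr_gt0.
have e : M.+1%:R / M.+2%:R - 1 = - M.+2%:R^-1 :> R.
  rewrite -[X in _ - X](divff (lt0r_neq0 M2)) -mulrBl -(natr1 M.+1).
  by rewrite opprD addrA subrr sub0r mulN1r.
by rewrite ln_div ?posrE // e lerBlDl -lerBrDr.
Qed.

Lemma sum_inv_distance_le (M z : nat) : (z <= M)%N ->
  \sum_(t < M.+1) (((z - t) + (t - z)).+1%:R : R)^-1 <= 2 * (1 + ln M.+1%:R).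
Proof.
move=> zM; pose H k : R := \sum_(0 <= t < k) (t.+1%:R)^-1.
have H_le k l : (k <= l)%N -> H k <= H l.
  move=> kl; rewrite /H (big_cat_nat (n := k) (p := l)) //= lerDl.
  by apply: sumr_ge0 => i _; rewrite invr_ge0.
rewrite -(big_mkord xpredT (fun t => (((z - t) + (t - z)).+1%:R : R)^-1)).
rewrite (big_cat_nat (n := z)) //=; last exact: leqW.
have HM : H M.+1 <= 1 + ln M.+1%:R by exact: harmonic_sum_le.
rewrite mulr_natl mulr2n; apply: lerD; apply: le_trans HM.
  apply: le_trans (H_le z _ (leqW zM)); rewrite big_nat_rev /=.
  rewrite /H !big_nat; apply: ler_sum => t /andP[_ tz].
  by rewrite lef_pV2 ?posrE ?ltr0n // ler_nat; lia.
apply: le_trans (H_le (M.+1 - z)%N _ (leq_subr _ _)).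
rewrite -{1}[z]add0n big_addn /H !big_nat; apply: ler_sum => t _.
by rewrite lef_pV2 ?posrE ?ltr0n // ler_nat; lia.
Qed.

End harmonic.

(** The lattice sum behind the logarithm: distributing the product over the
    coordinates turns it into a power of a harmonic sum. *)
Lemma sum_prod_inv_distance_le (R : realType) (m M : nat) (K : R) (z : {ffun 'I_m -> 'I_M.+1}) :
  0 <= K ->
  \sum_(z' : {ffun 'I_m -> 'I_M.+1})
     \prod_(i < m) (K / ((z i - z' i) + (z' i - z i)).+1%:R)
    <= (2 * K * (1 + ln M.+1%:R)) ^+ m.
Proof.
move=> K0; rewrite -(bigA_distr_bigA (fun i (t : 'I_M.+1) => K / ((z i - t) + (t - z i)).+1%:R)) /=.
apply: le_trans (_ : \prod_(i < m) (2 * K * (1 + ln M.+1%:R)) <= _); last first.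
  by rewrite prodr_const card_ord.
apply: ler_prod => i _; apply/andP; split.
  by apply: sumr_ge0 => t _; rewrite divr_ge0.
by rewrite -mulr_sumr (mulrC 2 K) -mulrA ler_wpM2l // sum_inv_distance_le // -ltnS.
Qed.


Section covering_number.
Variables (R : realType) (n : nat).
Implicit Types (A : set 'rV[R]_n) (r : R).

Definition covers r A k := exists F : 'I_k -> set 'rV[R]_n,
  (forall i, diam (F i) = r%:E) /\ A `<=` \bigcup_i F i.

Lemma covering_number_le r A k : covers r A k ->
  (covering_number r A <= k%:R%:E)%E.
Proof. by move=> ck; apply: ereal_inf_lbound; exists k. Qed.

(** The infimum is attained, being over integers. *)
Lemma covering_numberP r A k : A !=set0 -> covers r A k ->
  exists N, [/\ (0 < N)%N, covers r A N & covering_number r A = N%:R%:E].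
Proof.
move=> [x Ax] ck.
have ex : exists k, `[< covers r A k >] by exists k; apply/asboolP.
exists (ex_minn ex); case: ex_minnP => N /asboolP cN Nmin; split => //.
  case: N cN {Nmin} => // -[F [_ /(_ x Ax) [i _ _]]].
  by case: i.
apply/eqP; rewrite eq_le covering_number_le //=.
apply: le_ereal_inf_tmp => _ [l cl <-]; rewrite lee_fin ler_nat.
by apply: Nmin; apply/asboolP.
Qed.

Lemma diam_closed_ball (c : 'rV[R]_n) r : (0 < n)%N -> 0 < r ->
  diam [set y | enorm (y - c) <= r / 2] = r%:E.
Proof.
move=> n0 r0; apply/eqP; rewrite eq_le; apply/andP; split.
  apply: ge_ereal_sup => _ [x /= xc [y /= yc <-]]; rewrite lee_fin.
  apply: le_trans (enorm_triangleB x c y) _.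
  by rewrite (enormB c y) (splitr r) lerD.
pose e : 'rV[R]_n := (r / 2) *: 'e_(Ordinal n0).
have ee : enorm e = r / 2.
  by rewrite enormZ enorm_delta mulr1 ger0_norm // divr_ge0 // ltW.
apply: ereal_sup_ubound; exists (c + e) => /=; first by rewrite addrC addKr ee.
exists (c - e) => /=; first by rewrite addrC addKr enormN ee.
rewrite opprB addrC addrA addrNK -mulr2n -scaler_nat enormZ ee ger0_norm //.
by rewrite mulrC divfK // pnatr_eq0.
Qed.

End covering_number.

Lemma inf_energy_le_finset (R : realType) (n m : nat) (E : set 'rV[R]_n)
    (I : finType) (S : {set I}) (e : I -> 'rV[R]_n) r :
  E !=set0 -> compact E -> 0 < r -> (0 < #|S|)%N ->
  (forall z, z \in S -> E (e z)) ->
  inf_energy m r E <= #|S|%:R^-1 ^+ 2 *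
    \sum_(z in S) \sum_(z' in S) phi r m%:R (e z - e z').
Proof.
move=> E0 cE r0 S0 eE.
have [z0 z0S] : exists z, z \in S by apply/card_gt0P.
pose x k := e (nth z0 (enum S) k).
have sumE (F : 'rV[R]_n -> R) :
    \sum_(z in S) F (e z) = \sum_(i < #|S|.-1.+1) F (x i).
  rewrite prednK // -big_enum /= (big_nth z0) big_mkord -cardE.
  by [].
rewrite (sumE (fun u => \sum_(z' in S) phi r m%:R (u - e z'))).
rewrite (eq_bigr (fun i : 'I__ => \sum_(j < #|S|.-1.+1) phi r m%:R (x i - x j)));
  last by move=> i _; exact: (sumE (fun v => phi r m%:R (x i - v))).
rewrite -{1}(prednK S0); apply: inf_energy_le_uniform => // k kS.
by apply: eE; rewrite -mem_enum mem_nth // -cardE -(prednK S0) ltnS.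
Qed.


Section cells.
Variables (R : realType) (n m : nat).
Variables (V : {vspace 'rV[R]_n}) (E : set 'rV[R]_n).
Hypotheses (m0 : (0 < m)%N) (dimV : \dim V = m) (n0 : (0 < n)%N).
Hypotheses (E0 : E !=set0) (cE : compact E).

(** Cut [V] into cubes of side [h], comparable to [r], in adapted coordinates,
    and keep one point of [E] above each cube met by the projection. The
    uniform measure on these points has energy at most the inverse of their
    number, up to a power of a logarithm, since [phi] is of order at most
    [\prod_i 1 / (d_i + 1)] on cubes that are [d_i] apart in direction [i]. *)
Lemma covering_projection_le : exists a b : R, [/\ 0 < a, 0 < b &
  forall r, 0 < r <= 1 -> exists2 N, covers r (orthoproj V @` E) N &
    N%:R <= (a + b * - ln r) ^+ m * (inf_energy m r E)^-1].
Proof.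
have [f [u [uV u1 uf Vu]]] := adapted_basis dimV.
have [B B0 EB] := compact_enorm_bounded cE.
have [c cmn c0] : exists2 c : R, c = (m * n)%:R & 0 < c.
  by exists (m * n)%:R; rewrite ?ltr0n ?muln_gt0 ?m0.
pose K : R := 2 * c + 2; pose D : R := 2 * B * (2 * c) + 1.
have K0 : 0 < K by rewrite /K; lra.
have D1 : 1 <= D by rewrite /D lerDr !mulr_ge0 // ltW.
exists (2 * K * (1 + ln D)), (2 * K); split; rewrite ?mulr_gt0 //.
  by rewrite ltr_wpDr // ln_ge0.
move=> r /andP[r0 r1].
(* The side [h] makes the cubes so small that they have diameter at most
   [r / 2], and fit in balls of diameter [r]. *)
pose h := r / (2 * c).
have h0 : 0 < h by rewrite divr_gt0 // mulr_gt0.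
pose p x : 'rV[R]_n := orthoproj V x.
(* The shift by [B] makes the coordinates nonnegative. *)
pose t x i := (p x 0 (f i) + B) / h.
have t_ge0 x i : E x -> 0 <= t x i.
  move=> Ex; rewrite divr_ge0 ?(ltW h0) // -lerBlDr sub0r.
  have := le_trans (coord_le_enorm (p x) (f i)) (le_trans (enorm_orthoproj_le V x) (EB x Ex)).
  by rewrite ler_norml => /andP[].
pose M := Num.truncn (2 * B / h).
have t_le x i : E x -> t x i <= 2 * B / h.
  move=> Ex; rewrite ler_pM2r ?invr_gt0 // mulr_natl mulr2n lerD2r.
  apply: le_trans (ler_norm _) _.
  exact: le_trans (coord_le_enorm (p x) (f i)) (le_trans (enorm_orthoproj_le V x) (EB x Ex)).
pose cell x : {ffun 'I_m -> 'I_M.+1} := [ffun i => inord (Num.truncn (t x i))].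
have cellE x i : E x -> cell x i = Num.truncn (t x i) :> nat.
  by move=> Ex; rewrite ffunE inordK // ltnS le_truncn // t_le.
have coordB x y i : p x 0 (f i) - p y 0 (f i) = h * (t x i - t y i).
  by rewrite /t; field; rewrite gt_eqF.
pose S := [set z : {ffun 'I_m -> 'I_M.+1} | `[< exists2 x, E x & cell x = z >]]%SET.
have /choice[e eP] z : exists x, z \in S -> E x /\ cell x = z.
  have [zS|] := boolP (z \in S); last by exists 0.
  by move: (zS); rewrite inE => /asboolP[x Ex xz]; exists x.
have eE z (zS : z \in S) : E (e z) := (eP z zS).1.
have ecell z (zS : z \in S) : cell (e z) = z := (eP z zS).2.
have cellS x : E x -> cell x \in S by move=> Ex; rewrite inE; apply/asboolP; exists x.
have S0 : (0 < #|S|)%N.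
  by have [x Ex] := E0; apply/card_gt0P; exists (cell x); exact: cellS.
have closeE x y : E x -> E y -> cell x = cell y -> enorm (p x - p y) <= r / 2.
  move=> Ex Ey xy.
  have -> : r / 2 = c * h by rewrite /h; field; rewrite gt_eqF.
  have vV : p x - p y \in V by rewrite rpredB // (orthoprojP V _).1.
  rewrite cmn; apply: (enorm_le_adapted_coord u1 Vu vV) => i.
  rewrite !mxE coordB normrM gtr0_norm // -[leRHS]mulr1 ler_pM2l //.
  have := truncn_itv (t_ge0 x i Ex); have := truncn_itv (t_ge0 y i Ey).
  have -> : Num.truncn (t x i) = Num.truncn (t y i).
    by rewrite -!cellE // xy.
  rewrite -natr1 => /andP[? ?] /andP[? ?].
  by rewrite ler_norml; apply/andP; split; lra.
exists #|S|.
  exists (fun i => [set y | enorm (y - p (e (enum_val i))) <= r / 2]); split=> [i|].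
    exact: diam_closed_ball.
  move=> _ [x Ex <-]; exists (enum_rank_in (cellS x Ex) (cell x)) => //=.
  have cS := cellS x Ex; rewrite enum_rankK_in //.
  by apply: closeE; [|exact: eE|rewrite ecell].
have phi_le_prod z z' : z \in S -> z' \in S ->
    phi r m%:R (e z - e z') <= \prod_(i < m) (K / ((z i - z' i) + (z' i - z i)).+1%:R).
  move=> zS z'S; rewrite phi_natE // -[in X in _ ^+ X](card_ord m) -prodr_const.
  set x := e z - e z'.
  have M0 : 0 < Num.max r (enorm x) by rewrite lt_max r0.
  apply: ler_prod => i _; rewrite divr_ge0 ?(ltW r0) ?(ltW M0) //=.
  set d := (_ + _)%N.
  rewrite ler_pdivrMr // mulrAC ler_pdivlMr ?ltr0n //.
  have xd : h * (d%:R - 1) <= enorm x.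
    apply: le_trans (enorm_orthoproj_le V x).
    apply: le_trans (coord_le_enorm _ (f i)).
    rewrite /x linearB /= !mxE -/(p _) -/(p _) coordB normrM gtr0_norm // ler_pM2l //.
    have := truncn_itv (t_ge0 (e z) i (eE z zS)).
    have := truncn_itv (t_ge0 (e z') i (eE z' z'S)).
    rewrite -(cellE _ i (eE z zS)) -(cellE _ i (eE z' z'S)) !ecell // -!natr1.
    move=> /andP[? ?] /andP[? ?].
    rewrite /d; have [le_zz'|le_zz'] := leqP (z i) (z' i).
      rewrite (eqP le_zz') add0n natrB // -normrN opprB.
      by apply: le_trans (ler_norm _); lra.
    rewrite (eqP (ltnW le_zz')) addn0 natrB 1?ltnW //.
    by apply: le_trans (ler_norm _); lra.
  have rM : r <= Num.max r (enorm x) by rewrite le_max lexx.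
  have xM : enorm x <= Num.max r (enorm x) by rewrite le_max lexx orbT.
  have -> : r * d.+1%:R = 2 * c * (h * (d%:R - 1)) + 2 * r.
    by rewrite -natr1 /h; field; rewrite gt_eqF.
  have -> : K * Num.max r (enorm x) = 2 * c * Num.max r (enorm x) + 2 * Num.max r (enorm x).
    by rewrite /K mulrDl.
  apply: lerD; last by rewrite ler_pM2l.
  by rewrite ler_pM2l ?mulr_gt0 // (le_trans xd).
pose W := (2 * K * (1 + ln M.+1%:R)) ^+ m.
have I0 := inf_energy_gt0 m E0 cE r0.
have leW : inf_energy m r E <= #|S|%:R^-1 * W.
  apply: le_trans (inf_energy_le_finset m E0 cE r0 S0 eE) _.
  rewrite expr2 -mulrA ler_pM2l ?invr_gt0 ?ltr0n // ler_pdivrMl ?ltr0n //.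
  rewrite mulr_natl -sumr_const; apply: ler_sum => z zS.
  apply: le_trans (sum_prod_inv_distance_le z (ltW K0)).
  rewrite [leRHS](bigID (mem S)) /= ler_wpDr //.
    apply: sumr_ge0 => z' _; apply: prodr_ge0 => i _.
    by rewrite divr_ge0 // ltW.
  by apply: ler_sum => z' z'S; exact: phi_le_prod.
rewrite ler_pdivlMr //.
apply: le_trans (_ : W <= _); first by rewrite -ler_pdivlMl ?ltr0n.
have lnM0 : 0 <= ln M.+1%:R :> R by rewrite ln_ge0 // ler1n.
have lnM : ln M.+1%:R <= ln D - ln r.
  rewrite -ln_div ?posrE //; last exact: lt_le_trans D1.
  rewrite ler_ln ?posrE ?ltr0n ?divr_gt0 //; last exact: lt_le_trans D1.
  have Bh : 0 <= 2 * B / h by rewrite divr_ge0 ?(ltW h0) // mulr_ge0 // ltW.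
  have /andP[le_trunc _] := truncn_itv Bh.
  rewrite -natr1 (le_trans (lerD le_trunc (lexx _))) // /D (mulrDl (2 * B * (2 * c))) lerD //.
    by rewrite le_eqVlt; apply/orP; left; apply/eqP; rewrite /h; field; rewrite !gt_eqF.
  by rewrite mul1r invf_ge1.
have K2 : 0 < 2 * K by rewrite mulr_gt0.
have ge0 : 0 <= 2 * K * (1 + ln M.+1%:R) by rewrite mulr_ge0 ?(ltW K2) // addr_ge0.
have le : 2 * K * (1 + ln M.+1%:R) <= 2 * K * (1 + ln D) + 2 * K * - ln r.
  by rewrite -(mulrDr (2 * K)) ler_pM2l // -addrA lerD2l.
by apply: lerXn2r; rewrite ?nnegrE // (le_trans ge0).
Qed.

End cells.

(** * Growth exponents *)

Section limf_le.
Context (R : realType) (T : choiceType) (X : filteredType T) (F : set_system X).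
Context {FF : Filter F}.
Implicit Types u v : X -> \bar R.
Local Open Scope ereal_scope.

Lemma limf_esup_le_eps u v :
  (forall e : R, (0 < e)%R -> \forall r \near F, u r <= v r + e%:E) ->
  limf_esup u F <= limf_esup v F.
Proof.
move=> uv; apply/lee_addgt0Pr => e e0; rewrite -leeBlDr //.
apply: le_ereal_inf_tmp => _ [A FA <-]; rewrite leeBlDr //.
apply: le_trans (_ : ereal_sup (u @` (A `&` [set r | u r <= v r + e%:E])) <= _).
  apply: ereal_inf_lbound; exists (A `&` [set r | u r <= v r + e%:E]) => //.
  by apply: filterI => //; exact: uv.
apply: ge_ereal_sup => _ [r [Ar /= ur] <-]; apply: le_trans ur _.
by rewrite leeD2r //; apply: ereal_sup_ubound; exists r.
Qed.

Lemma limf_einf_le_eps u v :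
  (forall e : R, (0 < e)%R -> \forall r \near F, u r <= v r + e%:E) ->
  limf_einf u F <= limf_einf v F.
Proof.
move=> uv; rewrite leeN2; apply: limf_esup_le_eps => e e0.
have := uv e e0; apply: filterS => r ur.
by rewrite -leeBlDr // -oppeD // ?fin_num_adde_defl // leeN2.
Qed.

End limf_le.

Section growth_rate.
Variable R : realType.

(** From the tangent line bound [ln y <= y / c - 1 + ln c] with a large [c]. *)
Lemma polylog_le_eps (a b e : R) (p : nat) : 0 < a -> 0 < b -> 0 < e ->
  exists2 d : R, 0 < d <= 1 & forall r, 0 < r < d ->
    p%:R * ln (a + b * - ln r) <= e * - ln r.
Proof.
move=> a0 b0 e0; pose c := 2 * p%:R * b / e + 1.
have c0 : 0 < c by rewrite ltr_wpDl // divr_ge0 ?(ltW e0) // mulr_ge0 ?(ltW b0) // mulr_ge0.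
pose L0 := 2 * (p%:R * (a / c + `|ln c|)) / e.
have L00 : 0 <= L0.
  by rewrite divr_ge0 ?(ltW e0) // mulr_ge0 // mulr_ge0 // addr_ge0 // divr_ge0 // ltW.
exists (expR (- L0)); first by rewrite expR_gt0 -[X in _ <= X]expR0 ler_expR oppr_le0.
move=> r /andP[r0 rd].
have LL : L0 < - ln r by rewrite ltrNr -[X in _ < X]expRK ltr_ln ?posrE ?expR_gt0.
set L := - ln r in LL *; have Lpos := le_lt_trans L00 LL.
have y0 : 0 < a + b * L by rewrite addr_gt0 // mulr_gt0.
have lny : ln (a + b * L) <= (a + b * L) / c + `|ln c|.
  have -> : a + b * L = (a + b * L) / c * c by rewrite divfK // gt_eqF.
  rewrite lnM ?posrE ?divr_gt0 // mulfK ?gt_eqF // lerD ?ler_norm //.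
  have := @le_ln1Dx R ((a + b * L) / c - 1); rewrite addrCA subrr addr0.
  rewrite ltrBrDl subrr divr_gt0 // => /(_ isT) /le_trans; apply.
  by rewrite gerBl.
apply: le_trans (ler_wpM2l (ler0n _ p) lny) _.
have -> : p%:R * ((a + b * L) / c + `|ln c|) =
    p%:R * (a / c + `|ln c|) + p%:R * b / c * L by field; rewrite gt_eqF.
rewrite (splitr (e * L)) lerD //.
  by move: LL; rewrite ltr_pdivrMr // => /ltW; lra.
have -> : e * L / 2 = e / 2 * L by ring.
rewrite ler_pM2r // ler_pdivrMr //.
rewrite /c mulrDr mulr1.
have -> : e / 2 * (2 * p%:R * b / e) = p%:R * b by field; rewrite gt_eqF.
by rewrite lerDl divr_ge0 // ltW.
Qed.

Variables (x y : R -> \bar R) (a b : R) (p : nat).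
Hypotheses (a0 : 0 < a) (b0 : 0 < b).
Hypothesis xy : exists2 d : R, 0 < d & forall r, 0 < r < d ->
  exists xr yr : R, [/\ x r = xr%:E, y r = yr%:E, 0 < xr, 0 < yr &
    xr <= (a + b * - ln r) ^+ p * yr].

Let near_le (e : R) : 0 < e ->
  \forall r \near 0^'+, (lne (x r) / (- ln r)%:E <= lne (y r) / (- ln r)%:E + e%:E)%E.
Proof.
move=> e0; have [d d0 H] := xy.
have [d' /andP[d'0 d'1] H'] := polylog_le_eps p a0 b0 e0.
near=> r.
have r0 : 0 < r by near: r; exact: nbhs_right_gt.
have rd : r < d by near: r; exact: nbhs_right_lt.
have rd' : r < d' by near: r; exact: nbhs_right_lt.
have [|xr [yr [-> -> xr0 yr0 le]]] := H r; first by rewrite r0.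
have L0 : 0 < - ln r by rewrite oppr_gt0 ln_lt0 // r0 (lt_le_trans rd').
have poly0 : 0 < a + b * - ln r by rewrite addr_gt0 // mulr_gt0.
rewrite !lne_EFin // inver gt_eqF // -!EFinM -EFinD lee_fin.
rewrite ler_pdivrMr // mulrDl divfK ?gt_eqF //.
have := le; rewrite -ler_ln ?posrE ?mulr_gt0 ?exprn_gt0 //.
rewrite lnM ?posrE ?exprn_gt0 // lnXn // => /le_trans; apply.
by rewrite addrC lerD2l -mulr_natl H' // r0.
Unshelve. all: by end_near. Qed.

(** Factors that are polynomial in [- ln r] do not affect growth exponents. *)
Lemma limf_einf_growth_le :
  (limf_einf (fun r => lne (x r) / (- ln r)%:E) 0%R^'+ <=
   limf_einf (fun r => lne (y r) / (- ln r)%:E) 0%R^'+)%E.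
Proof. exact: limf_einf_le_eps. Qed.

Lemma limf_esup_growth_le :
  (limf_esup (fun r => lne (x r) / (- ln r)%:E) 0%R^'+ <=
   limf_esup (fun r => lne (y r) / (- ln r)%:E) 0%R^'+)%E.
Proof. exact: limf_esup_le_eps. Qed.

End growth_rate.

(** * Almost every projection *)

(** Cauchy-Schwarz, for the masses that [w] gives to [N] cells. *)
Lemma sum_cells_ge1 (R : realFieldType) (I : finType) N (w : I -> R) (l : I -> 'I_N) :
  \sum_i w i = 1 ->
  1 <= N%:R * \sum_i \sum_j w i * w j * (l i == l j)%:R.
Proof.
move=> w1; pose W k := \sum_i w i * (l i == k)%:R.
have W1 : \sum_k W k = 1.
  rewrite /W exchange_big /= -[RHS]w1; apply: eq_bigr => i _.
  rewrite (bigD1 (l i)) //= eqxx mulr1 big1 ?addr0 // => k ki.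
  by rewrite eq_sym (negbTE ki) mulr0.
have -> : \sum_i \sum_j w i * w j * (l i == l j)%:R = \sum_k W k ^+ 2.
  rewrite [RHS](eq_bigr (fun k => \sum_i \sum_j w i * w j *
      ((l i == k)%:R * (l j == k)%:R))); last first.
    move=> k _; rewrite expr2 /W mulr_suml; apply: eq_bigr => i _.
    by rewrite mulr_sumr; apply: eq_bigr => j _; ring.
  rewrite [RHS]exchange_big; apply: eq_bigr => i _ /=.
  rewrite [RHS]exchange_big; apply: eq_bigr => j _ /=.
  rewrite -mulr_sumr; congr (_ * _).
  rewrite (bigD1 (l i)) //= eqxx mul1r big1 ?addr0 1?eq_sym // => k ki.
  by rewrite eq_sym (negbTE ki) mul0r.
have : 0 <= \sum_k (N%:R * W k - 1) ^+ 2 by apply: sumr_ge0 => k _; rewrite sqr_ge0.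
have -> : \sum_k (N%:R * W k - 1) ^+ 2 =
    N%:R * (N%:R * (\sum_k W k ^+ 2) - 1).
  rewrite (eq_bigr (fun k => N%:R ^+ 2 * W k ^+ 2 - (2 * N%:R) * W k + 1)) => [|k _]; last ring.
  rewrite big_split sumrB /= -!mulr_sumr W1 sumr_const card_ord; ring.
have [N0|N0] := posnP N; last by rewrite pmulr_rge0 ?ltr0n // subr_ge0.
move: W1; rewrite big1 => [/eqP|[k kN]]; first by rewrite eq_sym oner_eq0.
by exfalso; move: kN; rewrite N0.
Qed.

Lemma sum_inv_mul_succ (R : realType) (n : nat) :
  \sum_(0 <= k < n) ((k.+1%:R * k.+2%:R)^-1 : R) = 1 - n.+1%:R^-1.
Proof.
elim: n => [|k IH]; first by rewrite big_geq // invr1 subrr.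
rewrite big_nat_recr //= IH.
have k1 : k.+1%:R != 0 :> R by rewrite pnatr_eq0.
have key (u : R) : u != 0 -> u + 1 != 0 ->
    1 - u^-1 + (u * (u + 1))^-1 = 1 - (u + 1)^-1.
  by move=> u0 u1; field; rewrite u0 u1.
by have := key k.+1%:R k1; rewrite natr1 pnatr_eq0; apply.
Qed.

Lemma le_sqrD1 (R : realFieldType) (c : R) : 0 < c -> c <= (c + 1) ^+ 2.
Proof. by move=> c0; nra. Qed.

Lemma mul_succ_le_sqr (R : realFieldType) (u L : R) : 0 <= u -> u <= L ->
  (u + 1) * (u + 1 + 1) <= (2 + L) ^+ 2.
Proof. by move=> u0 uL; nra. Qed.

Section almost_every.
Variables (R : realType) (n m : nat) (le_mn : (m <= n)%N).
Local Notation G := (grassmannian R le_mn).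
Variable gamma : probability (borel G) R.
Hypotheses (gamma_inv : orthogonal_invariant gamma) (n0 : (0 < n)%N).

Let C1 : R := ((4 * n ^ 2).+1%:R * expR 1) ^+ m.

Lemma gamma_slab_le_phi (s : R) (x : 'rV[R]_n) : 0 < s ->
  (gamma (slab x (expR 1 * s)) <= (C1 * phi s m%:R x)%:E)%E.
Proof.
move=> s0; rewrite phi_natE // /C1 -exprMn.
have q1 : 1 <= expR 1 :> R by rewrite -[X in X <= _]expR0 ler_expR.
have q0 : 0 < expR 1 :> R by rewrite expR_gt0.
have [xs|xs] := leP (enorm x) (expR 1 * s).
  apply: (@le_trans _ _ 1%E); first by apply: probability_le1; exact: measurable_slab.
  rewrite lee_fin exprn_ege1 // -mulrA mulr_ege1 // ?ler1n //.
  rewrite mulrA ler_pdivlMr ?lt_max ?s0 // mul1r ge_max xs andbT.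
  by rewrite ler_peMl // ltW.
have x0 : 0 < enorm x by apply: lt_trans xs; rewrite mulr_gt0.
have -> : Num.max s (enorm x) = enorm x.
  by rewrite max_r // (le_trans _ (ltW xs)) // ler_peMl // ltW.
have -> : expR 1 * s = expR 1 * s / enorm x * enorm x by rewrite divfK // gt_eqF.
have := @gamma_slab_le _ _ _ le_mn gamma gamma_inv x (expR 1 * s / enorm x) n0.
rewrite -enorm_gt0 x0 divr_gt0 ?mulr_gt0 //= ler_pdivrMr // mul1r ltW //.
move=> /(_ isT isT) /le_trans; apply; rewrite lee_fin.
by rewrite -!mulrA.
Qed.

Variable E : set 'rV[R]_n.
Hypotheses (E0 : E !=set0) (cE : compact E).

Let C2 : R := C1 * (2 * 3 ^+ m).

(** For a nearly minimizing measure with atoms [x i] of masses [w i], [f V] is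
    the measure of the pairs of points whose projections are close. Its mean
    is bounded by the energy, so it is rarely large, by Markov's inequality;
    where it is small, coverings are large, by Cauchy-Schwarz. *)
Lemma exists_exceptional_set (s t : R) : 0 < s -> 0 < t ->
  exists B : set (borel G), [/\ measurable B, (gamma B <= t^-1%:E)%E &
    forall (V : G), ~ B V -> forall r N, r <= expR 1 * s ->
      covers r (orthoproj (val V) @` E) N ->
      1 <= N%:R * (t * (C2 * inf_energy m s E))].
Proof.
move=> s0 t0; have I0 := inf_energy_gt0 m E0 cE s0.
have [K [x [w [xE w0 w1 le]]]] := exists_discrete_inf_energy m E0 cE s0.
have C10 : 0 < C1 by rewrite exprn_gt0 // mulr_gt0 ?expR_gt0 // ltr0n.
have C20 : 0 < C2 by rewrite !mulr_gt0 // exprn_gt0.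
pose A (ij : 'I_K * 'I_K) := slab (x ij.1 - x ij.2) (expR 1 * s) : set (borel G).
pose f (V : borel G) : R := \sum_ij w ij.1 * w ij.2 * \1_(A ij) V.
pose a := t * (C2 * inf_energy m s E).
have a0 : 0 < a by rewrite !mulr_gt0.
have mA ij : measurable (A ij) by exact: measurable_slab.
have ww0 ij : 0 <= w ij.1 * w ij.2 by rewrite mulr_ge0.
have mf : measurable_fun setT f.
  by apply: measurable_sum => ij; apply: measurable_funM.
pose B : set (borel G) := [set V | a < f V].
have mB : measurable B.
  have -> : B = setT `&` f @^-1` `]a, +oo[.
    by rewrite setTI; apply/seteqP; split=> V; rewrite /= in_itv /= andbT.
  exact: mf.
have intf : (\int[gamma]_V (f V)%:E <= (C2 * inf_energy m s E)%:E)%E.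
  rewrite (_ : (fun V => (f V)%:E) =
     (fun V => \sum_ij ((w ij.1 * w ij.2)%:E * (\1_(A ij) V)%:E))%E); last first.
    by apply/funext => V; rewrite -sumEFin.
  rewrite ge0_integral_sum //; last 2 first.
  - move=> ij; apply: emeasurable_funM => //.
    by apply/measurable_EFinP; exact: measurable_indic.
  - by move=> ij V _; rewrite mule_ge0 ?lee_fin.
  rewrite (eq_bigr (fun ij => (w ij.1 * w ij.2)%:E * gamma (A ij))%E); last first.
    move=> ij _; rewrite ge0_integralZl ?lee_fin //.
      by rewrite integral_indic // setIT.
    by apply/measurable_EFinP; exact: measurable_indic.
  apply: le_trans (_ : (\sum_ij
    (w ij.1 * w ij.2 * (C1 * phi s m%:R (x ij.1 - x ij.2)))%:E)%E <= _)%E.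
    apply: lee_sum => ij _; rewrite (EFinM (w ij.1 * w ij.2)) lee_wpmul2l ?lee_fin //.
    exact: gamma_slab_le_phi.
  rewrite sumEFin lee_fin /C2 -mulrA.
  rewrite (eq_bigr (fun ij => C1 * (w ij.1 * w ij.2 * phi s m%:R (x ij.1 - x ij.2)))).
    rewrite -mulr_sumr ler_pM2l //; apply: le_trans le.
    by rewrite pair_bigA.
  by move=> ij _; ring.
exists B; split => //.
  rewrite -(@lee_pmul2l _ a%:E) ?lte_fin //.
  have -> : (a%:E * (t^-1)%:E = (C2 * inf_energy m s E)%:E)%E.
    by rewrite -EFinM /a mulrAC mulfV ?gt_eqF // mul1r.
  apply: le_trans intf.
  have -> : (a%:E * gamma B =
      \int[gamma]_V (a%:E * (\1_B V)%:E))%E.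
    rewrite ge0_integralZl ?lee_fin ?(ltW a0) //.
      by rewrite integral_indic // setIT.
    by apply/measurable_EFinP; exact: measurable_indic.
  apply: ge0_le_integralT => V; first by rewrite mule_ge0 ?lee_fin // ltW.
  rewrite indicE -EFinM lee_fin.
  case: (boolP (V \in B)) => [|_]; first by rewrite inE mulr1 => /ltW.
  by rewrite mulr0; apply: sumr_ge0 => ij _; rewrite mulr_ge0.
move=> V /negP; rewrite -leNgt => fa r N rs [F [dF cF]].
have /choice[l lP] i : exists l, F l (orthoproj (val V) (x i)).
  have [|l _ Fl] := cF (orthoproj (val V) (x i)); last by exists l.
  by exists (x i).
apply: le_trans (sum_cells_ge1 l w1) _; rewrite ler_wpM2l //.
apply: le_trans fa; rewrite /f pair_bigA /=; apply: ler_sum => -[i j] _ /=.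
apply: ler_wpM2l; first exact: (ww0 (i, j)).
rewrite indicE ler_nat; case: eqVneq => //= lij.
rewrite mem_set // /A /slab /=; apply: le_trans rs.
rewrite -lee_fin -(dF (l i)) linearB /=.
apply: ereal_sup_ubound; exists (orthoproj (val V) (x i)) => //.
by exists (orthoproj (val V) (x j)) => //; rewrite lij.
Qed.

(** Borel-Cantelli along the scales [expR (- k)]: the exceptional sets have
    measures at most [1 / ((k + 1) (k + 2))]; these are summable, and their inverses
    are bounded by a power of [- ln r]. *)
Lemma capacity_le_covering_ae : exists (C : R) (Z : set (borel G)),
  [/\ 0 < C, gamma.-negligible Z & forall V : G, ~ Z V ->
    exists2 d : R, 0 < d <= 1 & forall r N, 0 < r < d ->
      covers r (orthoproj (val V) @` E) N ->
      (inf_energy m r E)^-1 <= (C * 2 + C * - ln r) ^+ 2 * N%:R].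
Proof.
have C20 : 0 < C2 by rewrite !mulr_gt0 ?exprn_gt0 // mulr_gt0 ?expR_gt0 ?ltr0n.
have [s sE] : exists s : nat -> R, forall k, s k = expR (- k.+1%:R).
  by exists (fun k => expR (- k.+1%:R)).
pose t (k : nat) : R := k.+1%:R * k.+2%:R.
have s0 k : 0 < s k by rewrite sE expR_gt0.
have t0 k : 0 < t k by rewrite mulr_gt0 ?ltr0n.
have /choice[B BP] k := exists_exceptional_set (s0 k) (t0 k).
have mB k : measurable (B k) by have [] := BP k.
exists (C2 + 1), (lim_sup_set B); split; first by rewrite addr_gt0.
  apply/negligibleP.
    by apply: bigcap_measurable => // k _; exact: bigcup_measurable.
  apply: lim_sup_set_cvg0 => //; apply: (@le_lt_trans _ _ 1%E); last exact: ltry.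
  apply: lime_le; first by apply: is_cvg_nneseries => k _ _; exact: measure_ge0.
  apply: nearW => k; apply: le_trans (_ : \sum_(0 <= i < k) ((t i)^-1)%:E <= _)%E.
    by apply: lee_sum => i _; have [] := BP i.
  by rewrite sumEFin sum_inv_mul_succ lee_fin gerBl invr_ge0.
move=> V nZ.
have [k0 Hk0] : exists k0, forall k, (k0 <= k)%N -> ~ B k V.
  apply: contrapT => H; apply: nZ => k _; apply: contrapT => H'.
  by apply: H; exists k => j kj Bj; apply: H'; exists j.
exists (expR (- k0%:R)); first by rewrite expR_gt0 -[X in _ <= X]expR0 ler_expR oppr_le0 ler0n.
move=> r N /andP[r0 rd] cN.
have lnr : k0%:R < - ln r by rewrite ltrNr -[X in _ < X]expRK ltr_ln ?posrE ?expR_gt0.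
set L := - ln r in lnr *.
have L0 : 0 <= L by rewrite (le_trans _ (ltW lnr)).
pose k := Num.truncn L; have /andP[kL Lk] := truncn_itv L0.
have rE : r = expR (- L) by rewrite opprK lnK ?posrE.
have k0k : (k0 <= k)%N.
  by rewrite -ltnS -(ltr_nat R) (lt_trans lnr).
have [_ _ /(_ V (Hk0 k k0k) r N)] := BP k.
have rs : r <= expR 1 * s k.
  by rewrite rE sE -expRD ler_expR -natr1 opprD addrCA subrr addr0 lerN2.
have sr : s k <= r by rewrite rE sE ler_expR lerN2 ltW.
have Ir := inf_energy_gt0 m E0 cE r0.
move=> /(_ rs cN) H.
have H1 : 1 <= N%:R * (t k * (C2 * inf_energy m r E)).
  apply: le_trans H _; apply: ler_wpM2l; first by rewrite ler0n.
  rewrite (ler_pM2l (t0 k)) (ler_pM2l C20).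
  exact: (le_inf_energy m E0 cE (s0 k) sr).
rewrite -[leLHS]mul1r ler_pdivrMr //.
apply: le_trans H1 _.
have -> : N%:R * (t k * (C2 * inf_energy m r E)) = (C2 * t k) * N%:R * inf_energy m r E by ring.
rewrite ler_pM2r // ler_wpM2r //.
rewrite -mulrDr exprMn; apply: ler_pM; [exact: ltW|exact: ltW|exact: le_sqrD1|].
by rewrite /t -(natr1 k.+1) -(natr1 k); apply: mul_succ_le_sqr.
Qed.

End almost_every.

Theorem theorem2p8 (R : realType) (n m : nat) (m_ge1 : (1 <= m)%N)
    (lt_mn : (m < n)%N) (E : set 'rV[R]_n) (E0 : E !=set0) (cE : compact E) :
  (forall V : grassmannian R (ltnW lt_mn),
     (lower_box_dim (orthoproj (val V) @` E) <= lower_dim_profile m%:R E)%E /\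
     (upper_box_dim (orthoproj (val V) @` E) <= upper_dim_profile m%:R E)%E) /\
  (forall gamma : probability (borel (grassmannian R (ltnW lt_mn))) R,
     orthogonal_invariant gamma ->
     {ae gamma, forall V : grassmannian R (ltnW lt_mn),
        lower_box_dim (orthoproj (val V) @` E) = lower_dim_profile m%:R E /\
        upper_box_dim (orthoproj (val V) @` E) = upper_dim_profile m%:R E}).
Proof.
have n0 : (0 < n)%N by exact: leq_ltn_trans lt_mn.
pose P (V : grassmannian R (ltnW lt_mn)) := orthoproj (val V) @` E.
have P0 V : P V !=set0 by have [x Ex] := E0; exists (orthoproj (val V) x); exists x.
have upper (V : grassmannian R (ltnW lt_mn)) : exists a b : R, [/\ 0 < a, 0 < b &
    forall r, 0 < r <= 1 -> exists N, [/\ (0 < N)%N, covers r (P V) N,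
      covering_number r (P V) = N%:R%:E &
      N%:R <= (a + b * - ln r) ^+ m * (inf_energy m r E)^-1]].
  have [a [b [a0 b0 H]]] := covering_projection_le m_ge1 (eqP (valP V)) n0 E0 cE.
  exists a, b; split => // r r01; have [N cN leN] := H r r01.
  have [N' [N'0 cN' N'E]] := covering_numberP (P0 V) cN.
  exists N'; split => //; apply: le_trans leN.
  by rewrite -lee_fin -N'E; exact: covering_number_le.
have le_profile (V : grassmannian R (ltnW lt_mn)) :
    (lower_box_dim (P V) <= lower_dim_profile m%:R E)%E /\
    (upper_box_dim (P V) <= upper_dim_profile m%:R E)%E.
  have [a [b [a0 b0 H]]] := upper V.
  have xy : exists2 d : R, 0 < d & forall r, 0 < r < d ->
      exists xr yr : R, [/\ covering_number r (P V) = xr%:E,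
        capacity r m%:R E = yr%:E, 0 < xr, 0 < yr & xr <= (a + b * - ln r) ^+ m * yr].
    exists 1 => // r /andP[r0 r1]; have [|N [N0 _ NE leN]] := H r.
      by rewrite r0 ltW.
    exists N%:R, (inf_energy m r E)^-1; split; rewrite ?ltr0n //.
      exact: capacityE.
    by rewrite invr_gt0 inf_energy_gt0.
  by split; [exact: (limf_einf_growth_le a0 b0 xy)|exact: (limf_esup_growth_le a0 b0 xy)].
split=> [V|gamma gamma_inv]; first exact: le_profile.
have [C [Z [C0 nZ HZ]]] := capacity_le_covering_ae gamma_inv n0 E0 cE.
apply: negligibleS nZ => V /= nV; apply: contrapT => ZV; apply: nV.
have [lo up] := le_profile V; have [a [b [a0 b0 H]]] := upper V.
have [d /andP[d0 d1] Hd] := HZ V ZV.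
have yx : exists2 d : R, 0 < d & forall r, 0 < r < d ->
    exists xr yr : R, [/\ capacity r m%:R E = xr%:E,
      covering_number r (P V) = yr%:E, 0 < xr, 0 < yr &
      xr <= (C * 2 + C * - ln r) ^+ 2 * yr].
  exists d => // r /andP[r0 rd].
  have [|N [N0 cN NE _]] := H r; first by rewrite r0 (le_trans (ltW rd)).
  exists (inf_energy m r E)^-1, N%:R; split; rewrite ?ltr0n //.
  - exact: capacityE.
  - by rewrite invr_gt0 inf_energy_gt0.
  - by apply: Hd; rewrite // r0.
have C20 : 0 < C * 2 by rewrite mulr_gt0.
split; apply/eqP; rewrite eq_le ?lo ?up /=.
  exact: (limf_einf_growth_le C20 C0 yx).
exact: (limf_esup_growth_le C20 C0 yx).
Qed.
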